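(* Let $0 \le k < d$ be integers and let $\varepsilon, \alpha, \eta > 0$ be real numbers. Then there exist constants $C$ and $C'$, depending only on $d,k,\varepsilon,\alpha,\eta$ (with $C'$ depending only on $d,k,\varepsilon,\alpha$), such that for every positive integer $N$ and every set $S \subseteq [N]^d$ which occupies fewer than $\alpha p^k$ residue classes modulo $p$ for every prime $p$, at least one of the following holds: (i) $|S| \le C' N^{k-1+\varepsilon}$; (ii) there exists a polynomial $f \in \mathbb{Z}[x_1,\ldots,x_d]$ of degree at most $C$, all of whose coefficients are bounded in absolute value by $N^C$, which vanishes at more than $(1-\eta)|S|$ points of $S$.
   Context: $[N]$ denotes the set of integers $\{0,1,\ldots,N\}$. A set $S \subseteq \mathbb{Z}^d$ is said to occupy $m$ residue classes modulo a prime $p$ if the image of $S$ under the reduction map $\mathbb{Z}^d \to (\mathbb{Z}/p\mathbb{Z})^d$ has exactly $m$ elements. *)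

(* Defs.v *)
From mathcomp Require Import all_boot all_order all_algebra.
From mathcomp Require Import mpoly.
From Stdlib Require Import Reals.
From mathcomp Require Import Rstruct.
Set Implicit Arguments. Unset Strict Implicit. Unset Printing Implicit Defensive.
Import GRing.Theory Num.Theory.

(* A point of [N]^d = {0,...,N}^d. *)
Definition gridpt (d N : nat) := {ffun 'I_d -> 'I_N.+1}.

Definition redmod (d N p : nat) (x : gridpt d N) : {ffun 'I_d -> nat} :=
  [ffun i => (x i : nat) %% p].

Definition nres (d N p : nat) (S : {set gridpt d N}) : nat :=
  size (undup [seq redmod p x | x <- enum S]).

Definition ptZ (d N : nat) (x : gridpt d N) : 'I_d -> int :=
  fun i => ((x i : nat) : int).

Definition tdeg (d : nat) (f : {mpoly int[d]}) : nat := (msize f).-1.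

Section PolyPreds.
Local Open Scope ring_scope.
Definition mpoly_nonzero (d : nat) (f : {mpoly int[d]}) : bool := f != 0.
Definition vanishes_at (d N : nat) (f : {mpoly int[d]}) (x : gridpt d N) : bool :=
  f.@[ptZ x] == 0.
Definition abscoef (d : nat) (f : {mpoly int[d]}) (m : 'X_{1..d}) : nat :=
  absz (f@_m).
End PolyPreds.

(* Main.v *)
(* If a polynomial [f] of bounded degree and height vanishes on [Z], and [x] agrees with points of
   [Z] modulo primes [p <= Q] whose logarithms add up to more than [log |f(x)|], then [f(x) = 0].
   It is thus enough to find [A] in [S] with [O(B^k)] points such that any set [Z] containing [A]
   and closed under this rule, with threshold [B log Q], contains most of [S]: as [k < d],
   Siegel's lemma gives a polynomial of degree [O(B)] vanishing on [A].

   The set [A] is built by induction on [k]. Each point of [S] is labelled by one of its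
   coordinates, chosen so that no label and value occur too often; this cuts [S] into sections.
   By Gallagher's larger sieve the labelling coordinate is well distributed modulo most primes
   (weighted by [log p / p]), so that a typical section occupies [O(p^(k-1))] classes for a
   positive proportion of the primes, and has a characteristic set by induction. A bounded multiple
   of [B] sections, chosen greedily, is enough to meet a typical point modulo primes whose logarithms
   add up to [2 B log Q], and the union of their characteristic sets is the set [A]. *)

Require Import Defs.
From mathcomp Require Import all_boot all_order all_algebra.
From mathcomp Require Import mpoly.
From mathcomp Require Import ring lra zify.
From Stdlib Require Reals.
From mathcomp Require Import Rstruct.
Set Implicit Arguments. Unset Strict Implicit. Unset Printing Implicit Defensive.
Import Order.TTheory GRing.Theory Num.Theory.
Local Open Scope ring_scope.

(** * Weighted sums over primes *)

(** Two weights are at work. The closure rule adds up [l p], whereas averages over primes use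
    [l p / p], because a typical slice modulo [p] has density [O(1 / p)]. Primes whose [l p] add up
    to [O(log Q)] are negligible for the second weight. The constant in [O(B^k)] must not grow with
    [B], since [B] is fixed after it, proportionally to the degree. This is possible because one
    section, whose labelling coordinate is fixed, meets a point modulo primes of total [O(log Q)]
    only. If a closed set misses a proportion [eta'] of every section, each of the [n0 * B] sections
    loses [O(eta' log Q)] on average against a threshold of order [B log Q], so [eta'] can be chosen
    independently of [B]. [Q] is a small power of [N]: [log N] is still [O(log Q)], while the powers
    of [Q] lost at each level of the induction are absorbed by [N^eps]. *)

Section Weights.
Variables (R : realFieldType) (l : nat -> R).

(* With [l p = ln p], the total weight [wsum l Q predT] is of order [ln Q]. *)
Definition lsum (Q : nat) (P : pred nat) : R := \sum_(p < Q.+1 | prime p && P p) l p.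
Definition wsum (Q : nat) (P : pred nat) : R := \sum_(p < Q.+1 | prime p && P p) l p / p%:R.

Hypothesis l_ge0 : forall p, prime p -> 0 <= l p.

Lemma weight_ge0 p : prime p -> 0 <= l p / p%:R.
Proof. by move=> pp; rewrite divr_ge0 ?l_ge0. Qed.

Lemma prime_natr_gt0 p : prime p -> 0 < p%:R :> R.
Proof. by move=> /prime_gt0; rewrite ltr0n. Qed.

Lemma lsum_ge0 Q P : 0 <= lsum Q P.
Proof. by apply: sumr_ge0 => p /andP[pp _]; apply: l_ge0. Qed.

Lemma wsum_ge0 Q P : 0 <= wsum Q P.
Proof. by apply: sumr_ge0 => p /andP[pp _]; apply: weight_ge0. Qed.

Lemma lsumE Q P : lsum Q P = \sum_(p < Q.+1 | prime p) l p * (P p)%:R.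
Proof.
rewrite /lsum big_mkcondr; apply: eq_bigr => p _.
by case: (P p); rewrite ?mulr1 ?mulr0.
Qed.

Lemma wsumE Q P : wsum Q P = \sum_(p < Q.+1 | prime p) l p / p%:R * (P p)%:R.
Proof.
rewrite /wsum big_mkcondr; apply: eq_bigr => p _.
by case: (P p); rewrite ?mulr1 ?mulr0.
Qed.

Lemma lsum_le Q (P P' : pred nat) :
  (forall p, prime p -> P p -> P' p) -> lsum Q P <= lsum Q P'.
Proof.
move=> PP'; rewrite !lsumE; apply: ler_sum => p pp.
apply: ler_wpM2l; first exact: l_ge0.
by have := PP' p pp; case: (P p) => // -> //; rewrite ler0n.
Qed.

Lemma wsum_le Q (P P' : pred nat) :
  (forall p, prime p -> P p -> P' p) -> wsum Q P <= wsum Q P'.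
Proof.
move=> PP'; rewrite !wsumE; apply: ler_sum => p pp.
apply: ler_wpM2l; first exact: weight_ge0.
by have := PP' p pp; case: (P p) => // -> //; rewrite ler0n.
Qed.

Lemma wsumU Q (P P' : pred nat) :
  wsum Q (fun p => P p || P' p) <= wsum Q P + wsum Q P'.
Proof.
rewrite !wsumE -big_split /=; apply: ler_sum => p pp.
rewrite -mulrDr; apply: ler_wpM2l; first exact: weight_ge0.
by case: (P p); case: (P' p); rewrite /= ?addr0 ?add0r ?lerDl ?ler01.
Qed.

Lemma wsum_le_wsumU Q (P P1 P2 : pred nat) :
  (forall p, prime p -> P p -> P1 p || P2 p) -> wsum Q P <= wsum Q P1 + wsum Q P2.
Proof. by move=> h; apply: le_trans (wsumU _ _ _); apply: wsum_le. Qed.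

Lemma sum_lsumE (T : finType) Q (A : {set T}) (P : T -> pred nat) :
  \sum_(x in A) lsum Q (P x) =
  \sum_(p < Q.+1 | prime p) l p * #|[set x in A | P x p]|%:R.
Proof.
under eq_bigr => x _ do rewrite lsumE.
rewrite exchange_big /=; apply: eq_bigr => p _.
by rewrite -mulr_sumr -natr_sum -sum1dep_card big_mkcondr /=; congr (_ * _%:R).
Qed.

Lemma sum_wsumE (T : finType) Q (A : {set T}) (P : T -> pred nat) :
  \sum_(x in A) wsum Q (P x) =
  \sum_(p < Q.+1 | prime p) l p / p%:R * #|[set x in A | P x p]|%:R.
Proof.
under eq_bigr => x _ do rewrite wsumE.
rewrite exchange_big /=; apply: eq_bigr => p _.
by rewrite -mulr_sumr -natr_sum -sum1dep_card big_mkcondr /=; congr (_ * _%:R).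
Qed.

Lemma sum_wsum_le (T : finType) Q (A : {set T}) (P : T -> pred nat) (c : R) :
  (forall p, prime p -> #|[set x in A | P x p]|%:R <= c) ->
  \sum_(x in A) wsum Q (P x) <= c * wsum Q predT.
Proof.
move=> h; rewrite sum_wsumE wsumE mulr_sumr; apply: ler_sum => p pp.
by rewrite /= mulr1 [leRHS]mulrC; apply: ler_wpM2l (h p pp); exact: weight_ge0.
Qed.

(** Each prime up to [Y] weighs at most 1, and beyond [Y] the factor [1 / p] is below [1 / Y]. With
    [Y] a large constant, primes whose [lsum] is of the order of [wsum l Q predT] become negligible
    for [wsum]. *)
Lemma wsum_lsum Q (P : pred nat) (Y : nat) :
  (forall p, prime p -> l p <= p%:R) -> (0 < Y)%N ->
  wsum Q P <= Y.+1%:R + lsum Q P / Y%:R.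
Proof.
move=> l_le Y0.
have -> : lsum Q P / Y%:R = \sum_(p < Q.+1 | prime p) l p / Y%:R * (P p)%:R.
  by rewrite lsumE mulr_suml; apply: eq_bigr => p _; rewrite mulrAC.
have hY : \sum_(p < Q.+1 | prime p) (p <= Y)%N%:R <= Y.+1%:R :> R.
  rewrite -natr_sum ler_nat.
  apply: (@leq_trans (\sum_(p < Q.+1) (p <= Y)%N)%N).
    by rewrite big_mkcond; apply: leq_sum => p _; case: ifP.
  rewrite -(big_mkord predT (fun p => (p <= Y)%N : nat)) -big_mkcond /= sum1_count.
  have -> : count (fun i => (i <= Y)%N) (index_iota 0 Q.+1) =
            size [seq i <- index_iota 0 Q.+1 | (i <= Y)%N] by rewrite size_filter.
  rewrite -[leqRHS](size_iota 0); apply: uniq_leq_size.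
    by rewrite filter_uniq // iota_uniq.
  by move=> i; rewrite mem_filter mem_iota /= add0n ltnS => /andP[].
apply: le_trans (lerD hY (lexx _)).
rewrite wsumE -big_split /=; apply: ler_sum => p pp.
have p0 := prime_natr_gt0 pp; have l0 := l_ge0 pp.
case: (P p); rewrite ?mulr0 ?addr0 ?mulr1 ?ler0n //.
case: leqP => [_|Yp] /=.
  rewrite -[leLHS]addr0 lerD // ?divr_ge0 //.
  by rewrite ler_pdivrMr // mul1r l_le.
rewrite add0r; apply: ler_wpM2l => //.
by rewrite lef_pV2 ?posrE // ?ltr0n // ler_nat ltnW.
Qed.

End Weights.

(** * Counting in finite sets *)

Lemma markov_card (R : realFieldType) (T : finType) (A : {set T}) (f : T -> R) (t M : R)
    (P : pred T) :
  (forall x, x \in A -> 0 <= f x) -> \sum_(x in A) f x <= M ->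
  (forall x, x \in A -> P x -> t <= f x) ->
  t * #|[set x in A | P x]|%:R <= M.
Proof.
move=> f0 hM ht; apply: le_trans hM.
rewrite -sum1dep_card natr_sum mulr_sumr big_mkcondr /=.
apply: ler_sum => x xA; case: ifP => [Px|_]; rewrite ?mulr1 ?f0 //.
exact: ht.
Qed.

Lemma card_fibres (T U : finType) (f : T -> U) (A : {set T}) :
  #|A| = (\sum_(u : U) #|[set x in A | f x == u]|)%N.
Proof.
rewrite -sum1_card (partition_big f predT) //=.
by apply: eq_bigr => u _; rewrite sum1dep_card.
Qed.

Lemma card_sum_swap (T U : finType) (A : {set T}) (B : {set U}) (P : T -> U -> bool) :
  (\sum_(x in A) #|[set y in B | P x y]| = \sum_(y in B) #|[set x in A | P x y]|)%N.
Proof.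
under eq_bigr => x _ do rewrite -sum1dep_card big_mkcondr /=.
rewrite exchange_big /=; apply: eq_bigr => y _.
by rewrite -sum1dep_card [RHS]big_mkcondr.
Qed.

Lemma sum_le_blocks (R : realFieldType) (T U : finType) (lab : T -> U) (S : {set T})
    (f : T -> R) (c : R) :
  (forall x, x \in S ->
     \sum_(z in [set z in S | lab z == lab x]) f z <= c * #|[set z in S | lab z == lab x]|%:R) ->
  \sum_(x in S) f x <= c * #|S|%:R.
Proof.
move=> h; rewrite (card_fibres lab S) natr_sum mulr_sumr (partition_big lab predT) //=.
apply: ler_sum => u _.
have [/existsP[x /andP[xS /eqP <-]]|/existsPn nex] := boolP [exists x, (x \in S) && (lab x == u)].
  apply: le_trans (h x xS); rewrite le_eqVlt; apply/orP; left; apply/eqP.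
  by apply: eq_bigl => z; rewrite inE.
rewrite big1; last by move=> z hz; have := nex z; rewrite hz.
rewrite (_ : [set _ in _ | _] = set0) ?cards0 ?mulr0 //.
by apply/setP => z; rewrite !inE; apply: negbTE; apply: nex.
Qed.

(** * Residue classes, sections and slices *)

Section Grid.
Variables (d N : nat).
Implicit Types (S A X : {set gridpt d N}) (x y z : gridpt d N) (p Q : nat).

(** A residue never exceeds the coordinate it comes from, so it fits in the grid again and residue
    classes live in a finite type. *)
Definition red p x : gridpt d N := [ffun i => inord (x i %% p)].

Definition cls p A x : {set gridpt d N} := [set y in A | red p y == red p x].

Lemma redE p x i : red p x i = (x i %% p)%N :> nat.
Proof. by rewrite ffunE inordK // (leq_ltn_trans (leq_mod _ _) (ltn_ord _)). Qed.

Lemma red_eqP p x y : reflect (forall i, x i = y i %[mod p]) (red p x == red p y).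
Proof.
apply: (iffP eqP) => [h i|h]; first by rewrite -!redE h.
by apply/ffunP => i; apply: val_inj; rewrite /= !redE.
Qed.

Lemma nresE p S : nres p S = #|[set red p x | x in S]|.
Proof.
rewrite /nres.
pose g (x : gridpt d N) : {ffun 'I_d -> nat} := [ffun i => x i : nat].
have gI : injective g.
  by move=> x y /ffunP gxy; apply/ffunP => i; apply: val_inj; have := gxy i; rewrite !ffunE.
have -> : [seq redmod p x | x <- enum S] = map g [seq red p x | x <- enum S].
  rewrite -map_comp; apply: eq_map => x /=; apply/ffunP => i.
  by rewrite /g [LHS]ffunE [RHS]ffunE redE.
rewrite (undup_map_inj gI) size_map -(card_uniqP (undup_uniq _)).
apply: eq_card => z; rewrite mem_undup.
apply/mapP/imsetP => [[x xS ->]|[x xS ->]]; exists x => //.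
  by rewrite mem_enum in xS.
by rewrite mem_enum.
Qed.

Lemma nres_subset p A S : A \subset S -> (nres p A <= nres p S)%N.
Proof. by move=> AS; rewrite !nresE subset_leq_card ?imsetS. Qed.

Lemma card_le_nres (R : realFieldType) p A S (t : R) :
  0 <= t -> A \subset S -> (forall x, x \in A -> #|cls p A x|%:R <= t) ->
  #|A|%:R <= (nres p S)%:R * t.
Proof.
move=> t0 AS h; apply: (@le_trans _ _ ((nres p A)%:R * t)); last first.
  by rewrite ler_wpM2r // ler_nat nres_subset.
rewrite -sum1_card (partition_big_imset (red p)) /= nresE natr_sum.
rewrite -[X in _ <= X%:R * _]sum1_card natr_sum mulr_suml; apply: ler_sum => u /imsetP[x xA ->].
by rewrite mul1r sum1dep_card; apply: h.
Qed.

Section Label.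
Variable iota : gridpt d N -> 'I_d.

Definition lab x : 'I_d * 'I_N.+1 := (iota x, x (iota x)).

Definition sec S x : {set gridpt d N} := [set y in S | lab y == lab x].

(** A section fixes the value of the labelling coordinate, a slice only its residue. The larger
    sieve bounds slices. *)
Definition slice p S x : {set gridpt d N} :=
  [set y in S | (iota y == iota x) && (y (iota y) == x (iota x) %[mod p])].

Lemma mem_sec S x : x \in S -> x \in sec S x.
Proof. by move=> xS; rewrite inE xS eqxx. Qed.

Lemma sec_eq S x y : y \in sec S x -> sec S y = sec S x.
Proof. by rewrite inE => /andP[_ /eqP e]; apply/setP => z; rewrite !inE e. Qed.

Lemma sec_sub S x : sec S x \subset S.
Proof. by apply/subsetP => y; rewrite inE => /andP[]. Qed.

(** There are at most [d * N.+1] sections, and a small one has fewer than [M / N] points. *)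
Lemma card_small_sections S M :
  (#|[set x in S | #|sec S x| * N < M]| * N <= d * N.+1 * M)%N.
Proof.
rewrite (card_fibres lab) big_distrl /=.
have -> : (d * N.+1 * M = \sum_(u : 'I_d * 'I_N.+1) M)%N.
  by rewrite sum_nat_const card_prod !card_ord.
apply: leq_sum => u _.
have [->|[x]] := set_0Vmem [set x in [set x in S | (#|sec S x| * N < M)%N] | lab x == u].
  by rewrite cards0.
rewrite !inE => /andP[/andP[xS xs] /eqP xu].
apply: leq_trans (ltnW xs); rewrite leq_mul2r; apply/orP; right.
apply: subset_leq_card; apply/subsetP => z; rewrite !inE => /andP[/andP[-> _] /eqP ->].
by rewrite xu eqxx.
Qed.

End Label.

(* The number of points with only popular coordinates is at most [Q ^ (2 * d)], so their label is
   irrelevant. *)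
Lemma label_exists (j0 : 'I_d) Q S : (0 < Q)%N -> (Q ^ (2 * d + 2) <= #|S|)%N ->
  exists iota, forall u, (#|[set z in S | lab iota z == u]| * Q ^ 2 <= #|S|)%N.
Proof.
move=> Q0 hS.
pose popular j (a : 'I_N.+1) := (#|S| < #|[set y in S | y j == a]| * Q ^ 2)%N.
pose iota x := if [pick j | ~~ popular j (x j)] is Some j then j else j0.
exists iota => -[j a].
have [pop|npop] := boolP (popular j a); last first.
  rewrite /popular -leqNgt in npop; apply: leq_trans npop; rewrite leq_mul2r; apply/orP; right.
  apply: subset_leq_card; apply/subsetP => z; rewrite !inE => /andP[-> /eqP[e1 e2]] /=.
  by rewrite -e2 e1.
have card_popular i : (#|[pred b | popular i b]| <= Q ^ 2)%N.
  have S0 : (0 < #|S|)%N by apply: leq_trans hS; rewrite expn_gt0 Q0.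
  rewrite -(leq_pmul2r S0) [leqRHS]mulnC.
  rewrite [in leqRHS](card_fibres (fun y : gridpt d N => y i) S) big_distrl /=.
  rewrite -sum_nat_const big_mkcond /=.
  by apply: leq_sum => b _; case: ifP => // /ltnW.
have sub : [set z in S | lab iota z == (j, a)] \subset
           [set z : gridpt d N | z \in finfun.family (fun i => [pred b | popular i b])].
  apply/subsetP => z; rewrite !inE => /andP[_ /eqP[e1 e2]].
  apply/familyP => i; rewrite inE; apply/negPn/negP => npi.
  move: e1 e2; rewrite /iota; case: pickP => [i' npi' e1 e2|/(_ i)]; last by rewrite npi.
  by move: npi'; rewrite e1 -e1 e2 e1 pop.
apply: leq_trans hS; rewrite expnD; apply: leq_mul => //.
apply: leq_trans (subset_leq_card sub) _; rewrite cardsE card_family.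
rewrite expnM foldrE big_map big_enum /=.
apply: (@leq_trans (\prod_(i : 'I_d) (Q ^ 2))%N); last by rewrite prod_nat_const card_ord.
apply: leq_prod => i _; exact: card_popular.
Qed.

End Grid.

(** Where [X] holds less than half of a class of [S], more than half of that class lies in
    [S :\: X]. Bounds on classes of [X] thus pass to most points of [S]. *)
Lemma card_minority (d N p : nat) (S X : {set gridpt d N}) :
  (#|[set x in S | 2 * #|cls p X x| < #|cls p S x|]| <= 2 * #|S :\: X|)%N.
Proof.
rewrite (card_fibres (red p) (S :\: X)) big_distrr /= (card_fibres (red p) _).
apply: leq_sum => u _.
have [->|[x]] := set_0Vmem [set x in [set x in S | 2 * #|cls p X x| < #|cls p S x|]%N | red p x == u].
  by rewrite cards0.
rewrite !inE => /andP[/andP[xS hx] /eqP xu].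
have h1 : (#|[set x in [set x in S | 2 * #|cls p X x| < #|cls p S x|] | red p x == u]|
           <= #|cls p S x|)%N.
  apply: subset_leq_card; apply/subsetP => z; rewrite !inE => /andP[/andP[-> _] /eqP ->].
  by rewrite xu eqxx.
have h2 : (#|cls p S x| <= #|cls p X x| + #|[set z in S :\: X | red p z == u]|)%N.
  apply: leq_trans (leq_card_setU _ _); apply: subset_leq_card; apply/subsetP => z.
  by rewrite !inE -xu => /andP[-> ->]; case: (z \in X).
apply: leq_trans h1 _; move: hx h2; set m := #|[set z in S :\: X | _]|; lia.
Qed.

(** * Size of a class modulo one prime, through sections and slices *)

Section ClassMass.
Variables (R : realFieldType) (d N : nat) (iota : gridpt d N -> 'I_d).
Variables (p k : nat) (S X : {set gridpt d N}) (K K3 : R).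
Hypotheses (p_gt0 : (0 < p)%N) (K0 : 0 <= K) (XS : X \subset S).
Hypothesis slice_le : forall x, x \in X -> #|slice iota p S x|%:R * p%:R <= K * #|S|%:R.
Hypothesis sec_le :
  forall x, x \in X -> #|cls p (sec iota S x) x|%:R * p%:R ^+ k <= K3 * #|sec iota S x|%:R.

Definition touching x : {set gridpt d N} :=
  [set y in S | [exists z in cls p X x, lab iota z == lab iota y]].

(** The touching sections labelled by a given coordinate [j] all have the value [x j] modulo [p]
    there, and so lie in a single slice. *)
Lemma card_touching x : #|touching x|%:R * p%:R <= d%:R * K * #|S|%:R.
Proof.
rewrite (card_fibres iota) natr_sum mulr_suml.
have -> : d%:R * K * #|S|%:R = \sum_(j < d) K * #|S|%:R.
  by rewrite sumr_const card_ord -[RHS]mulr_natl mulrA.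
apply: ler_sum => j _.
have [->|[y0]] := set_0Vmem [set y in touching x | iota y == j].
  by rewrite cards0 mul0r mulr_ge0.
rewrite !inE => /andP[/andP[_ /existsP[z0 /andP[z0x /eqP[e0 e0']]]] /eqP j0].
have z0X : z0 \in X by move: z0x; rewrite inE => /andP[].
apply: le_trans (slice_le z0X); rewrite ler_wpM2r // ler_nat.
apply: subset_leq_card; apply/subsetP => y; rewrite !inE.
move=> /andP[/andP[-> /existsP[z /andP[zx /eqP[e e']]]] /eqP yj] /=.
rewrite yj e0 j0 eqxx /=.
move: zx z0x; rewrite !inE => /andP[_ /eqP zx] /andP[_ /eqP z0x].
have /red_eqP h : red p z == red p z0 by rewrite zx z0x.
by move: e'; rewrite e yj => <-; rewrite h.
Qed.

(** Each touching section contains a point of [X] congruent to [x], so by [sec_le] the class takes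
    up at most a proportion [K3 / p^k] of it; these sections partition [touching x]. *)
Lemma card_cls_le_touching x :
  #|cls p X x|%:R * p%:R ^+ k <= K3 * #|touching x|%:R.
Proof.
have pk0 : 0 < p%:R ^+ k :> R by rewrite exprn_gt0 // ltr0n.
have clsT : cls p X x \subset touching x.
  apply/subsetP => z zx; rewrite inE; apply/andP; split.
    by move: zx; rewrite inE => /andP[/(subsetP XS)].
  by apply/existsP; exists z; rewrite zx eqxx.
have -> : #|cls p X x|%:R = \sum_(y in touching x) (y \in cls p X x)%:R :> R.
  rewrite -natr_sum -big_mkcondr /= -sum1_card; congr _%:R.
  by apply: eq_bigl => y; apply/idP/andP => [yx|[]//]; rewrite (subsetP clsT).
rewrite -ler_pdivlMr // mulrAC.
apply: (@sum_le_blocks _ _ _ (lab iota)) => y yT.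
rewrite -natr_sum -big_mkcondr /= sum1dep_card.
move: (yT); rewrite inE => /andP[yS /existsP[z /andP[zx /eqP ezy]]].
have zX : z \in X by move: zx; rewrite inE => /andP[].
have secE : [set w in touching x | lab iota w == lab iota y] = sec iota S z.
  apply/setP => w; rewrite !inE ezy -andbA; apply: andb_id2l => wS.
  apply/andb_idl => /eqP e; apply/existsP; exists z; rewrite e ezy eqxx andbT.
  by move: zx; rewrite inE.
rewrite secE mulrAC ler_pdivlMr //; apply: le_trans (sec_le zX).
rewrite ler_wpM2r ?(ltW pk0) // ler_nat; apply: subset_leq_card.
apply/subsetP => w; rewrite inE => /andP[wz wx].
rewrite inE wz /=.
by move: wx zx; rewrite !inE => /andP[_ /eqP ->] /andP[_ /eqP ->].
Qed.

Lemma card_cls_le x : 0 <= K3 ->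
  #|cls p X x|%:R * p%:R ^+ k.+1 <= d%:R * (K * K3) * #|S|%:R.
Proof.
move=> K30; have p0 : 0 <= p%:R :> R by [].
rewrite exprSr mulrA; apply: le_trans (ler_wpM2r p0 (card_cls_le_touching x)) _.
rewrite -[leLHS]mulrA; apply: le_trans (ler_wpM2l K30 (card_touching x)) _.
by rewrite le_eqVlt; apply/orP; left; apply/eqP; ring.
Qed.

End ClassMass.

(** The number theory used by the sieve, for an abstract weight [l] that will be the logarithm.
    [ar_pair] expresses that the primes dividing [a - b] have product at most [N], itself at most a
    fixed power of [Q]; [ar_tot] is the trivial bound [Q log Q] up to a constant. *)
Record arith (R : realFieldType) (l : nat -> R) (G : R) (N Q : nat) : Prop := Arith {
  ar_ge0 : forall p, prime p -> 0 <= l p;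
  ar_le : forall p, prime p -> l p <= p%:R;
  ar_G : 1 <= G;
  ar_N : (0 < N)%N;
  ar_Q : (0 < Q)%N;
  ar_pair : forall a b : nat, (a <= N)%N -> (b <= N)%N -> a != b ->
    lsum l Q (fun p => a == b %[mod p]) <= G * wsum l Q predT;
  ar_tot : lsum l Q predT <= G * Q%:R * wsum l Q predT }.

(** * Gallagher's larger sieve *)

Section Arith.
Variables (R : realFieldType) (l : nat -> R) (G : R) (N Q : nat).
Hypothesis ar : arith l G N Q.
Let L := wsum l Q predT.

Lemma ar_L_ge0 : 0 <= L.
Proof. exact: wsum_ge0 (ar_ge0 ar) _ _. Qed.

Lemma ar_L_le : L <= Q.+1%:R.
Proof.
have -> : Q.+1%:R = \sum_(p < Q.+1) 1 :> R by rewrite sumr_const card_ord.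
rewrite /L wsumE [leLHS]big_mkcond; apply: ler_sum => p _.
case: ifP => // pp; rewrite /= mulr1 ler_pdivrMr ?prime_natr_gt0 // mul1r.
exact: ar_le ar _ pp.
Qed.

Lemma ar_pairpt d (x y : gridpt d N) : x != y ->
  lsum l Q (fun p => red p x == red p y) <= G * L.
Proof.
move=> xy; have [i xyi] : exists i, x i != y i.
  by apply/existsP; apply: contraR xy => /existsPn h; apply/eqP/ffunP => i;
     apply/eqP; have := h i; rewrite negbK.
apply: le_trans (ar_pair ar (leq_ord (x i)) (leq_ord (y i)) xyi).
apply: (lsum_le (ar_ge0 ar)) => p _ /red_eqP h; exact/eqP.
Qed.

Section Slice.
Variables (d : nat) (iota : gridpt d N -> 'I_d) (S : {set gridpt d N}).
Hypothesis fib : forall u, (#|[set z in S | lab iota z == u]| * Q ^ 2 <= #|S|)%N.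

(* The larger sieve: pairs with distinct labels agree modulo primes of bounded total weight. *)
Lemma slice_mass K : 0 < K ->
  \sum_(x in S) wsum l Q (fun p => K * #|S|%:R < #|slice iota p S x|%:R * p%:R)
    <= 2 * G / K * L * #|S|%:R.
Proof.
move=> K0; have [->|S0] := eqVneq S set0; first by rewrite big_set0 cards0 mulr0.
have s0 : 0 < #|S|%:R :> R by rewrite ltr0n card_gt0.
have G0 : 0 <= G by apply: le_trans (ar_G ar).
have L0 := ar_L_ge0.
have key x : x \in S ->
    K * #|S|%:R * wsum l Q (fun p => K * #|S|%:R < #|slice iota p S x|%:R * p%:R)
      <= 2 * G * L * #|S|%:R.
  move=> xS.
  apply: (@le_trans _ _ (\sum_(p < Q.+1 | prime p) l p * #|slice iota p S x|%:R)).
    rewrite wsumE mulr_sumr; apply: ler_sum => p pp.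
    have l0 := ar_ge0 ar pp; have p0 := prime_natr_gt0 R pp.
    case: ltP => [h|_]; last by rewrite !mulr0 mulr_ge0.
    rewrite mulr1 mulrCA; apply: ler_wpM2l => //.
    by rewrite ler_pdivrMr // ltW.
  rewrite -(sum_lsumE _ _ _
    (fun y p => (iota y == iota x) && (y (iota y) == x (iota x) %[mod p]))).
  (* Points with the same label agree in that coordinate modulo every prime and cost the trivial
     bound [ar_tot]; [fib] makes them rare enough to pay for its factor [Q]. *)
  apply: (@le_trans _ _ (\sum_(y in S) (G * L + (lab iota y == lab iota x)%:R * (G * Q%:R * L)))).
    apply: ler_sum => y yS; have [_|ne] /= := boolP (lab iota y == lab iota x).
      rewrite mul1r -[leLHS]add0r; apply: lerD; first exact: mulr_ge0.
      by apply: le_trans (ar_tot ar); exact: (lsum_le (ar_ge0 ar)).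
    rewrite mul0r addr0.
    have [e|ne2] := eqVneq (iota y) (iota x); last first.
      by apply: le_trans (_ : 0 <= _); rewrite ?mulr_ge0 // /lsum big_pred0 // => p; rewrite andbF.
    apply: ar_pair ar _ _ (leq_ord _) (leq_ord _) _.
    by apply: contra ne => /eqP e2; rewrite /lab e xpair_eqE eqxx /=; apply/eqP/val_inj; rewrite /= -e2 e.
  rewrite big_split /= sumr_const -mulr_suml -natr_sum -big_mkcondr /= sum1dep_card.
  have h1 : (#|sec iota S x| * Q <= #|S|)%N.
    by apply: leq_trans (fib (lab iota x)); rewrite leq_mul2l -{1}[Q]expn1 leq_pexp2l ?orbT ?(ar_Q ar).
  have h2 : #|sec iota S x|%:R * Q%:R <= #|S|%:R :> R by rewrite -natrM ler_nat.
  have h3 := ler_wpM2r (mulr_ge0 G0 L0) h2.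
  rewrite -[_ *+ #|_|]mulr_natl; rewrite /sec in h3; lra.
rewrite -(ler_pM2l (mulr_gt0 K0 s0)) mulr_sumr.
apply: (@le_trans _ _ (\sum_(x in S) 2 * G * L * #|S|%:R)); first by apply: ler_sum => x /key.
rewrite sumr_const -[_ *+ #|_|]mulr_natl le_eqVlt; apply/orP; left; apply/eqP; field.
by rewrite gt_eqF.
Qed.

End Slice.

(** Passing from [k.+1] to [k] gives up a factor [N], the order of the number of labels, and a
    factor [Q], which leaves only a proportion [2 * d / Q] of the points in sections too small for
    the next level. The factor [Q ^ (2 * d + 2)] pays for the labelling. *)
Lemma slicing_exists d (j0 : 'I_d) k (S : {set gridpt d N}) :
  (N ^ k.+1 * Q ^ (2 * d + 2 + k.+1) <= #|S| * N)%N ->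
  exists2 iota : gridpt d N -> 'I_d,
    forall u, (#|[set z in S | lab iota z == u]| * Q ^ 2 <= #|S|)%N &
    (#|[set x in S | #|sec iota S x| * N < N ^ k * Q ^ (2 * d + 2 + k)]| * Q <= 2 * d * #|S|)%N.
Proof.
have N0 := ar_N ar; have Q0 := ar_Q ar => h.
have h1 : (N ^ k * Q ^ (2 * d + 2 + k) * Q <= #|S|)%N.
  rewrite -(leq_pmul2r N0); apply: leq_trans h.
  by rewrite (expnS N) (addnS (2 * d + 2) k) (expnS Q) leq_eqVlt; apply/orP; left; apply/eqP; ring.
have h2 : (Q ^ (2 * d + 2) <= #|S|)%N.
  apply: leq_trans h1; apply: (@leq_trans (Q ^ (2 * d + 2 + k))).
    by rewrite leq_pexp2l // leq_addr.
  by rewrite -mulnA mulnCA leq_pmulr // muln_gt0 expn_gt0 N0 Q0.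
have [iota hi] := label_exists j0 Q0 h2.
exists iota => //; have := card_small_sections iota S (N ^ k * Q ^ (2 * d + 2 + k)).
set c := #|_| => h3; rewrite -(leq_pmul2r N0) mulnAC.
apply: leq_trans (leq_mul h3 (leqnn Q)) _.
rewrite -[leqLHS]mulnA; apply: leq_trans (leq_mul (leqnn _) h1) _.
rewrite [leqLHS]mulnAC (_ : 2 * d * #|S| * N = d * #|S| * (2 * N))%N; last by ring.
by rewrite leq_mul2l; apply/orP; right; lia.
Qed.

End Arith.

Lemma wsum_pred0 (R : realFieldType) (l : nat -> R) Q (P : pred nat) :
  (forall p, ~~ P p) -> wsum l Q P = 0.
Proof. by move=> h; rewrite /wsum big_pred0 // => p; rewrite (negbTE (h p)) andbF. Qed.

Lemma sum_wsum_if (R : realFieldType) (l : nat -> R) (T : finType) (S : {set T}) (b : pred T) Q :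
  \sum_(x in S) wsum l Q (fun=> b x) = wsum l Q predT * #|[set x in S | b x]|%:R.
Proof.
rewrite -sum1dep_card natr_sum mulr_sumr big_mkcondr /=; apply: eq_bigr => x _.
by case: (b x); [rewrite mulr1 | rewrite wsum_pred0].
Qed.

(* From the size bound alone, a typical class of [S] modulo a typical [p] has density
   [O(p^-k)]: a higher dimensional form of Gallagher's larger sieve. *)
Lemma classes_spread (R : realFieldType) (l : nat -> R) (d : nat) (j0 : 'I_d) (G : R) (k : nat) :
  1 <= G -> forall eta : R, 0 < eta ->
  exists K q0 : R, 0 < K /\
    forall N Q (S : {set gridpt d N}), arith l G N Q -> q0 <= wsum l Q predT ->
      (N ^ k * Q ^ (2 * d + 2 + k) <= #|S| * N)%N ->
      \sum_(x in S) wsum l Q (fun p => K * #|S|%:R < #|cls p S x|%:R * p%:R ^+ k)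
        <= eta * wsum l Q predT * #|S|%:R.
Proof.
move=> G1; have G0 : 0 < G by apply: lt_le_trans G1.
elim: k => [|k IH] eta eta0.
  exists 1, 0; split=> // N Q S ar _ _; rewrite big1; last first.
    move=> x _; apply: wsum_pred0 => p; rewrite -leNgt expr0 mulr1 mul1r ler_nat.
    by apply: subset_leq_card; apply/subsetP => y; rewrite inE => /andP[].
  by rewrite !mulr_ge0 ?(ltW eta0) ?(ar_L_ge0 ar).
have [K1 [q1 [K10 hK1]]] := IH (eta / 8) ltac:(lra).
pose K2 := 16 * G / eta.
have K20 : 0 < K2 by rewrite divr_gt0 // mulr_gt0.
exists (2 * d%:R * (K2 * K1) + 1), (Num.max q1 (16 * d%:R / eta + 1)); split.
  by have := mulr_ge0 (ler0n R d) (ltW (mulr_gt0 K20 K10)); lra.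
move=> N Q S ar; rewrite ge_max => /andP[q1L q2L] hS.
set L := wsum l Q predT in q1L q2L *; set s := #|S|%:R.
have L0 : 0 <= L := ar_L_ge0 ar.
have [iota fib small] := slicing_exists ar j0 hS.
pose large x := (N ^ k * Q ^ (2 * d + 2 + k) <= #|sec iota S x| * N)%N.
pose bad2 x p := K2 * s < #|slice iota p S x|%:R * p%:R.
pose bad3 x p := large x && (K1 * #|sec iota S x|%:R < #|cls p (sec iota S x) x|%:R * p%:R ^+ k).
pose bad x p := [|| ~~ large x, bad2 x p | bad3 x p].
have Q0 : 0 < Q%:R :> R by rewrite ltr0n (ar_Q ar).
have b1 : \sum_(x in S) wsum l Q (fun=> ~~ large x) <= eta / 8 * L * s.
  rewrite sum_wsum_if -/L [eta / 8 * L]mulrC -mulrA; apply: ler_wpM2l => //.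
  have -> : [set x in S | ~~ large x] =
      [set x in S | #|sec iota S x| * N < N ^ k * Q ^ (2 * d + 2 + k)]%N.
    by apply/setP => x; rewrite !inE -ltnNge.
  move: small; rewrite -(ler_nat R) !natrM => small.
  have hQ : 16 * d%:R <= eta * Q%:R.
    rewrite -ler_pdivrMl // mulrC; have := ar_L_le ar; rewrite -/L -natr1; lra.
  rewrite -(ler_pM2r Q0); apply: le_trans small _.
  have s0 : 0 <= s by [].
  rewrite -/s; have := ler_wpM2r s0 hQ; lra.
have b2 : \sum_(x in S) wsum l Q (bad2 x) <= eta / 8 * L * s.
  apply: le_trans (slice_mass ar fib K20) _; rewrite -/L -/s.
  rewrite le_eqVlt; apply/orP; left; apply/eqP; rewrite /K2; field.
  by rewrite !gt_eqF.
have b3 : \sum_(x in S) wsum l Q (bad3 x) <= eta / 8 * L * s.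
  apply: (sum_le_blocks (lab := lab iota)) => x xS.
  rewrite -/(sec iota S x).
  have [lx|nlx] := boolP (large x); last first.
    rewrite big1 ?mulr_ge0 ?invr_ge0 ?(ltW eta0) //.
    move=> z zx; apply: wsum_pred0 => p; rewrite /bad3.
    have -> : large z = large x by rewrite /large (sec_eq zx).
    by rewrite (negbTE nlx).
  apply: le_trans (hK1 N Q _ ar q1L lx); apply: ler_sum => z zx.
  by apply: (wsum_le (ar_ge0 ar)) => p _; rewrite /bad3 (sec_eq zx) => /andP[].
have bsum : \sum_(x in S) wsum l Q (bad x) <= 3 * eta / 8 * L * s.
  apply: (@le_trans _ _ (\sum_(x in S) (wsum l Q (fun=> ~~ large x) +
                                       (wsum l Q (bad2 x) + wsum l Q (bad3 x))))).
    apply: ler_sum => x _; apply: le_trans (wsumU (ar_ge0 ar) _ _ _) _.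
    by apply: lerD => //; apply: wsumU (ar_ge0 ar) _ _ _.
  rewrite !big_split /=; lra.
(* Modulo [p], let [X] be the points that are not bad. [card_cls_le] bounds the classes of [X], so a
   point of [S] in an overfull class has less than half of that class in [X]; by [card_minority]
   there are at most twice as many of these as bad points. *)
apply: (@le_trans _ _ (2 * \sum_(x in S) wsum l Q (bad x))); last first.
  have : 0 <= eta * L * s by rewrite !mulr_ge0 // ltW.
  lra.
rewrite !sum_wsumE mulr_sumr; apply: ler_sum => p pp.
rewrite [leRHS]mulrCA. apply: ler_wpM2l; first exact: weight_ge0 (ar_ge0 ar) _ pp.
pose X := [set x in S | ~~ bad x p].
have XS : X \subset S by apply/subsetP => x; rewrite inE => /andP[].
have XC : [set x in S | bad x p] = S :\: X.
  by apply/setP => x; rewrite !inE; case: (x \in S); rewrite ?andbF //= negbK andbT.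
have := card_minority p S X; rewrite -(ler_nat R) natrM XC; apply: le_trans.
rewrite ler_nat.
apply: subset_leq_card; apply/subsetP => x; rewrite !inE => /andP[-> hx] /=.
have Xprop y : y \in X -> [/\ #|slice iota p S y|%:R * p%:R <= K2 * #|S|%:R &
    #|cls p (sec iota S y) y|%:R * p%:R ^+ k <= K1 * #|sec iota S y|%:R].
  rewrite inE /bad !negb_or negbK => /and4P[_ ly]; rewrite -leNgt => h2.
  by rewrite /bad3 ly /= -leNgt.
have pp0 := prime_gt0 pp.
have := @card_cls_le R d N iota p k S X K2 K1 pp0 (ltW K20) XS
  (fun y yX => proj1 (Xprop y yX)) (fun y yX => proj2 (Xprop y yX)) x (ltW K10).
rewrite -/s => hX.
have pk : 0 < p%:R ^+ k.+1 :> R by rewrite exprn_gt0 // ltr0n.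
rewrite -(ltr_nat R) natrM -(ltr_pM2r pk); apply: le_lt_trans hx.
have s0 : 0 <= s by [].
lra.
Qed.

(** Count pairs of a point [x] and a class of [S] that agree in the coordinate labelling [x]. A
    section with too many classes puts [x] in more than [alpha' * p ^ k] pairs. A class is in at
    most [d * K * #|S| / p] of them, one slice for each coordinate, and there are at most
    [alpha * p ^ k.+1] classes. *)
Lemma card_rich_sections (R : realFieldType) (d N : nat) (iota : gridpt d N -> 'I_d)
    (S : {set gridpt d N}) (p k : nat) (alpha alpha' K : R) :
  (0 < p)%N -> 0 <= K -> (nres p S)%:R <= alpha * p%:R ^+ k.+1 ->
  #|[set x in S | (alpha' * p%:R ^+ k < (nres p (sec iota S x))%:R)
                  && (#|slice iota p S x|%:R * p%:R <= K * #|S|%:R)]|%:R * alpha'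
    <= d%:R * alpha * K * #|S|%:R.
Proof.
move=> p0 K0 hS; set Y := [set x in S | _].
have pp : 0 < p%:R :> R by rewrite ltr0n.
pose I := [set red p y | y in S].
pose rel (x t : gridpt d N) := t (iota x) == x (iota x) %[mod p].
have h1 x : x \in Y -> alpha' * p%:R ^+ k <= #|[set t in I | rel x t]|%:R.
  rewrite inE => /and3P[xS hx _]; apply: le_trans (ltW hx) _; rewrite ler_nat nresE.
  apply: subset_leq_card; apply/subsetP => t /imsetP[y yx ->].
  rewrite inE in yx; case/andP: yx => yS /eqP[e1 e2].
  by rewrite inE /rel redE modn_mod -e1 e2 e1 eqxx andbT; apply: imset_f.
have h2 t : #|[set x in Y | rel x t]|%:R * p%:R <= d%:R * K * #|S|%:R.
  rewrite (card_fibres iota) natr_sum mulr_suml.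
  have -> : d%:R * K * #|S|%:R = \sum_(j < d) K * #|S|%:R.
    by rewrite sumr_const card_ord -[RHS]mulr_natl mulrA.
  apply: ler_sum => j _.
  have [->|[x0]] := set_0Vmem [set x in [set x in Y | rel x t] | iota x == j].
    by rewrite cards0 mul0r mulr_ge0.
  rewrite !inE => /andP[/andP[/and3P[x0S _ hx0] /eqP r0] /eqP e0].
  apply: le_trans hx0; apply: ler_wpM2r; first exact: ltW.
  rewrite ler_nat.
  apply: subset_leq_card; apply/subsetP => x.
  rewrite !inE => /andP[/andP[/and3P[-> _ _] /eqP r] /eqP e] /=.
  by rewrite e e0 eqxx /=; apply/eqP; move: r0 r; rewrite e e0 => <- ->.
have h3 : #|Y|%:R * (alpha' * p%:R ^+ k) <= (\sum_(t in I) #|[set x in Y | rel x t]|)%:R.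
  rewrite -card_sum_swap natr_sum mulr_natl -sumr_const.
  by apply: ler_sum => x; exact: h1.
have h4 : (\sum_(t in I) #|[set x in Y | rel x t]|)%:R * p%:R
            <= (nres p S)%:R * (d%:R * K * #|S|%:R).
  rewrite natr_sum mulr_suml nresE mulr_natl -sumr_const.
  by apply: ler_sum => t _; exact: h2.
have pk : 0 < p%:R ^+ k.+1 :> R by rewrite exprn_gt0.
rewrite -(ler_pM2r pk).
have h5 := ler_wpM2r (ltW pp) h3.
have h6 : 0 <= d%:R * K * #|S|%:R by rewrite !mulr_ge0.
have h7 := ler_wpM2r h6 hS.
rewrite exprSr in h7 *; lra.
Qed.

(** * Sections that meet a given class *)

Section Covering.
Variables (R : realFieldType) (d N : nat) (iota : gridpt d N -> 'I_d).
Variables (p k : nat) (S X : {set gridpt d N}) (K K3 : R).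
Hypotheses (p_gt0 : (0 < p)%N) (K0 : 0 < K) (K30 : 0 < K3) (XS : X \subset S).
Hypothesis slice_le : forall x, x \in X -> #|slice iota p S x|%:R * p%:R <= K * #|S|%:R.
Hypothesis sec_le :
  forall x, x \in X -> #|cls p (sec iota S x) x|%:R * p%:R ^+ k <= K3 * #|sec iota S x|%:R.

(** A sum over the points [y] counts a section once for each of its points; division by its size
    restores weight one. *)
Lemma card_cls_average x :
  #|cls p X x|%:R = \sum_(y in S) #|cls p (X :&: sec iota S y) x|%:R / #|sec iota S y|%:R :> R.
Proof.
have -> : \sum_(y in S) #|cls p (X :&: sec iota S y) x|%:R / #|sec iota S y|%:R =
    \sum_(y in S) \sum_(w in cls p X x | lab iota w == lab iota y) (#|sec iota S w|%:R^-1) :> R.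
  apply: eq_bigr => y yS.
  rewrite (eq_bigr (fun=> #|sec iota S y|%:R^-1)); last first.
    by move=> w /andP[wx e]; rewrite (@sec_eq _ _ _ S y w) // inE e (subsetP XS) //;
       move: wx; rewrite inE => /andP[].
  rewrite sumr_const -[RHS]mulr_natl; congr (_%:R * _); apply: eq_card => w.
  rewrite [RHS]unfold_in /= !inE.
  by case wX: (w \in X) => //=; rewrite (subsetP XS _ wX) /= andbC.
rewrite (exchange_big_dep (mem (cls p X x))) /=; last by move=> y w _ /andP[].
rewrite -sum1_card natr_sum; apply: eq_bigr => w wx.
have wS : w \in S by apply: (subsetP XS); move: wx; rewrite inE => /andP[].
rewrite (eq_bigl (mem (sec iota S w))); last first.
  by move=> y; rewrite wx [in RHS]/= inE /= eq_sym.
rewrite sumr_const -[RHS]mulr_natl divff // pnatr_eq0 -lt0n.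
by apply/card_gt0P; exists w; apply: mem_sec.
Qed.

(** Sections below the threshold [c / (2 * d * K)] contribute, by [card_touching], at most half of
    the assumed lower bound for the class. The rest comes from sections with at most a proportion
    [K3 / p ^ k] in the class, so there are many of these. *)
Lemma card_covering x (c : R) : 0 <= c -> (0 < d)%N ->
  c * #|S|%:R <= #|cls p X x|%:R * p%:R ^+ k.+1 ->
  c / (2 * K3) * #|S|%:R <=
  #|[set y in S | c / (2 * d%:R * K) * #|sec iota S y|%:R
                  <= #|cls p (X :&: sec iota S y) x|%:R * p%:R ^+ k]|%:R * p%:R.
Proof.
move=> c0 d0 hc; set cr := c / (2 * d%:R * K); set Y := [set y in S | _].
have dR : 0 < d%:R :> R by rewrite ltr0n.
have cr0 : 0 <= cr by rewrite divr_ge0 // !mulr_ge0 // ltW.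
have h1 : #|cls p X x|%:R * p%:R ^+ k <= K3 * #|Y|%:R + cr * #|touching iota p S X x|%:R.
  rewrite card_cls_average mulr_suml.
  apply: (@le_trans _ _ (\sum_(y in S) (K3 * (y \in Y)%:R + cr * (y \in touching iota p S X x)%:R))).
    apply: ler_sum => y yS.
    have sy : 0 < #|sec iota S y|%:R :> R.
      by rewrite ltr0n; apply/card_gt0P; exists y; apply: mem_sec.
    rewrite mulrAC ler_pdivrMr //.
    have [yY|yY] := boolP (y \in Y).
      apply: (@le_trans _ _ (K3 * #|sec iota S y|%:R)); last first.
        by rewrite ler_wpM2r // mulr1 lerDl mulr_ge0.
      have [->|[w]] := set_0Vmem (cls p (X :&: sec iota S y) x).
        by rewrite cards0 mul0r mulr_ge0 // ltW.
      rewrite !inE => /andP[/andP[wX /andP[wS wy]] wx].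
      have es : sec iota S w = sec iota S y by apply: sec_eq; rewrite inE wS.
      have := sec_le wX; rewrite es; apply: le_trans.
      rewrite ler_wpM2r ?exprn_ge0 // ler_nat; apply: subset_leq_card.
      apply/subsetP => v; rewrite !inE => /andP[/andP[_ /andP[-> ->]]] /eqP ->.
      by rewrite eq_sym wx.
    have lt : #|cls p (X :&: sec iota S y) x|%:R * p%:R ^+ k < cr * #|sec iota S y|%:R.
      by move: yY; rewrite inE yS /= -ltNge.
    rewrite mulr0 add0r.
    have [yT|yT] := boolP (y \in touching iota p S X x); first by rewrite mulr1 ltW.
    rewrite mulr0 mul0r.
    have [->|[w]] := set_0Vmem (cls p (X :&: sec iota S y) x); first by rewrite cards0 mul0r.
    rewrite !inE => /andP[/andP[wX /andP[wS wy]] wx].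
    move: yT; rewrite inE yS => /existsPn /(_ w); rewrite wy andbT.
    by rewrite inE wX wx.
  rewrite big_split /= -!mulr_sumr -!natr_sum -!big_mkcondr /=.
  rewrite le_eqVlt; apply/orP; left; apply/eqP; congr (_ * _%:R + _ * _%:R);
    rewrite -[RHS]sum1_card; apply: eq_bigl => y; rewrite !inE; case: (y \in S) => //.
have pR : 0 <= p%:R :> R by [].
have h2 := ler_wpM2r pR h1.
have h3 := ler_wpM2l cr0 (card_touching (ltW K0) slice_le x).
have h4 : cr * (d%:R * K * #|S|%:R) = c / 2 * #|S|%:R.
  by rewrite /cr; field; rewrite !gt_eqF.
have h5 : c / (2 * K3) * #|S|%:R = (c / 2 * #|S|%:R) / K3.
  by field; rewrite gt_eqF.
rewrite h5 ler_pdivrMr //.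
rewrite exprSr in hc; lra.
Qed.

(** If [Z] misses the class of [x], all the points of the section in that class lie in the small set
    [sec iota S y :\: Z]. By [card_cls_le] each of them is congruent to few points of [X], and
    counting congruent pairs bounds the number of such [x]. *)
Lemma card_missed (Z : {set gridpt d N}) y (cr eta : R) :
  0 <= cr -> y \in S -> #|sec iota S y :\: Z|%:R <= eta * #|sec iota S y|%:R ->
  cr * #|[set x in X | (cr * #|sec iota S y|%:R <= #|cls p (X :&: sec iota S y) x|%:R * p%:R ^+ k)
              && ~~ [exists z in Z, red p z == red p x]]|%:R * p%:R
    <= eta * (d%:R * (K * K3)) * #|S|%:R.
Proof.
move=> cr0 yS hZ; set E := [set x in X | _].
have sy : 0 < #|sec iota S y|%:R :> R.
  by rewrite ltr0n; apply/card_gt0P; exists y; apply: mem_sec.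
have pR : 0 <= p%:R :> R by [].
have pk : 0 <= p%:R ^+ k :> R by rewrite exprn_ge0.
have h1 : #|E|%:R * (cr * #|sec iota S y|%:R) <=
    (\sum_(x in E) #|[set z in sec iota S y :\: Z | red p z == red p x]|)%:R * p%:R ^+ k.
  rewrite natr_sum mulr_suml mulr_natl -sumr_const; apply: ler_sum => x.
  rewrite inE => /and3P[xX hx /existsPn nx]; apply: le_trans hx _.
  rewrite ler_wpM2r // ler_nat; apply: subset_leq_card; apply/subsetP => z.
  rewrite 2!inE => /andP[/andP[_ zy] zx].
  rewrite inE in zy.
  rewrite 3!inE zy zx /= !andbT.
  by have := nx z; rewrite zx andbT.
rewrite card_sum_swap in h1.
have h2 : (\sum_(z in sec iota S y :\: Z) #|[set x in E | red p z == red p x]|)%:R * p%:R ^+ k.+1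
    <= #|sec iota S y :\: Z|%:R * (d%:R * (K * K3) * #|S|%:R).
  rewrite natr_sum mulr_suml mulr_natl -sumr_const; apply: ler_sum => z _.
  apply: le_trans (card_cls_le p_gt0 (ltW K0) XS slice_le sec_le z (ltW K30)).
  rewrite ler_wpM2r ?exprn_ge0 // ler_nat; apply: subset_leq_card; apply/subsetP => x.
  by rewrite !inE => /andP[/andP[-> _] /eqP ->]; rewrite eqxx.
have D0 : 0 <= d%:R * (K * K3) * #|S|%:R by rewrite !mulr_ge0 // ltW.
have h3 := ler_wpM2r D0 hZ.
have h4 := ler_wpM2r pR h1.
rewrite -(ler_pM2r sy); rewrite exprSr in h2; lra.
Qed.

End Covering.

(** * Greedy covering *)

Section Greedy.
Variables (R : realFieldType) (l : nat -> R) (Q : nat) (T : finType).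
Variables (S : {set T}) (rel : T -> T -> pred nat).
Hypothesis l_ge0 : forall p, prime p -> 0 <= l p.

Definition covered (s : seq T) (x : T) : pred nat := fun p => has (fun y => rel y x p) s.

Lemma lsum_covered_cons y s x :
  lsum l Q (covered (y :: s) x) =
  lsum l Q (covered s x) + lsum l Q (fun p => rel y x p && ~~ covered s x p).
Proof.
rewrite !lsumE -big_split /=; apply: eq_bigr => p _; rewrite -mulrDr; congr (_ * _).
by case: (rel y x p); case: (covered s x p); rewrite ?addr0 ?add0r.
Qed.

(* The potential [\sum_x min(lsum (covered s x), M + D)] is bounded, and increases by at least
   [rho * c * #|S|] when the best next element is appended to [s]. *)
Lemma greedy_covering (U : {set T}) (M D c rho : R) (n : nat) :
  0 <= M -> 0 <= D -> 0 <= rho -> 0 < c -> U \subset S ->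
  (forall s x, x \in U -> lsum l Q (covered s x) < M ->
     c * #|S|%:R <=
     \sum_(y in S) Num.min (lsum l Q (fun p => rel y x p && ~~ covered s x p)) D) ->
  M + D < rho * c * n%:R ->
  exists s : seq T, [/\ (size s <= n)%N, {subset s <= S} &
    #|[set x in U | lsum l Q (covered s x) < M]|%:R <= rho * #|S|%:R].
Proof.
move=> M0 D0 rho0 c0 US gain nbig.
pose bad s := [set x in U | lsum l Q (covered s x) < M].
have [S0|S0] := eqVneq S set0.
  exists [::]; split=> //.
  have -> : [set x in U | lsum l Q (covered [::] x) < M] = set0.
    by apply/setP => x; move: US; rewrite S0 subset0 => /eqP ->; rewrite !inE.
  by rewrite cards0 mulr_ge0.
have sS : 0 < #|S|%:R :> R by rewrite ltr0n card_gt0.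
pose Psi s := \sum_(x in U) Num.min (lsum l Q (covered s x)) (M + D).
have Psi_le s : Psi s <= (M + D) * #|S|%:R.
  apply: (@le_trans _ _ (\sum_(x in U) (M + D))).
    by apply: ler_sum => x _; rewrite ge_min lexx orbT.
  by rewrite sumr_const -[leLHS]mulr_natr ler_wpM2l ?addr_ge0 // ler_nat subset_leq_card.
suff step m : (exists s, [/\ (size s <= m)%N, {subset s <= S} & #|bad s|%:R <= rho * #|S|%:R]) \/
    (exists s, [/\ size s = m, {subset s <= S} & rho * c * m%:R * #|S|%:R <= Psi s]).
  have [//|[s [_ _ hs]]] := step n.
  by have := le_trans hs (Psi_le s); rewrite ler_pM2r // leNgt nbig.
elim: m => [|m [[s [h1 h2 h3]]|[s [h1 h2 h3]]]].
- right; exists [::]; split=> //; rewrite mulr0 mul0r; apply: sumr_ge0 => x _.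
  by rewrite le_min lsum_ge0 //= addr_ge0.
- by left; exists s; split=> //; apply: leqW.
have [hb|hb] := leP (#|bad s|%:R) (rho * #|S|%:R).
  by left; exists s; split=> //; rewrite h1.
right.
have [y [yS hy]] : exists y, y \in S /\ rho * c * #|S|%:R <= Psi (y :: s) - Psi s.
  have [/existsP[y /andP[yS hy]]|/existsPn nex] :=
    boolP [exists y, (y \in S) && (rho * c * #|S|%:R <= Psi (y :: s) - Psi s)]; first by exists y.
  exfalso.
  have up : \sum_(y in S) (Psi (y :: s) - Psi s) <= \sum_(y in S) rho * c * #|S|%:R.
    by apply: ler_sum => y yS; have := nex y; rewrite yS /= -ltNge => /ltW.
  have low : c * #|S|%:R * #|bad s|%:R <= \sum_(y in S) (Psi (y :: s) - Psi s).
    rewrite [leRHS](eq_bigr (fun y => \sum_(x in U)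
      (Num.min (lsum l Q (covered (y :: s) x)) (M + D) - Num.min (lsum l Q (covered s x)) (M + D))));
      last by move=> y _; rewrite /Psi -sumrB.
    rewrite exchange_big /= -sum1dep_card natr_sum mulr_sumr big_mkcondr /=.
    apply: ler_sum => x xU; case: ifP => hx.
      rewrite mulr1; apply: le_trans (gain s x xU hx) _; apply: ler_sum => y _.
      rewrite lsum_covered_cons; set a := lsum _ _ (fun p => _ && _); set b := lsum _ _ _ in hx *.
      (* As [b < M], the cap [M + D] leaves room for an increase of [D], so no gain counted in the
         hypothesis is lost. *)
      have -> : Num.min b (M + D) = b by apply/min_idPl; rewrite ltW // (lt_le_trans hx) // lerDl.
      have : 0 <= a by apply: lsum_ge0.
      case: (leP a D); case: (leP (b + a) (M + D)); lra.
    apply: sumr_ge0 => y _; rewrite subr_ge0 lsum_covered_cons.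
    set a := lsum _ _ (fun p => _ && _); set b := lsum _ _ _.
    have : 0 <= a by apply: lsum_ge0.
    by case: (leP b (M + D)); case: (leP (b + a) (M + D)); lra.
  have := le_trans low up; rewrite sumr_const -[_ *+ #|_|]mulr_natr => h.
  have h' := ltr_pM2l (mulr_gt0 c0 sS) (rho * #|S|%:R) #|bad s|%:R.
  rewrite hb in h'; lra.
exists (y :: s); split; first by rewrite /= h1.
  by move=> z; rewrite inE => /orP[/eqP ->|/h2].
by rewrite -natr1; lra.
Qed.

End Greedy.

(** While [x] is covered only up to [M], the primes already used are negligible by [wsum_lsum], and
    half of the weight of the good primes is still free; an average [y] covers a share [c / p] of
    it. The [y] failing [ok] are too rare to matter even at the trivial cost [ar_tot]. *)
Lemma covering_gain (R : realFieldType) (l : nat -> R) (G : R) (N Q d : nat)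
    (S : {set gridpt d N}) (rel : gridpt d N -> gridpt d N -> pred nat)
    (s : seq (gridpt d N)) (x : gridpt d N) (good : pred nat) (ok : pred (gridpt d N))
    (kappa c M : R) (Y : nat) :
  let L := wsum l Q predT in
  arith l G N Q -> 0 <= c ->
  kappa * L <= wsum l Q good ->
  (forall p, prime p -> good p -> c * #|S|%:R <= #|[set y in S | rel y x p]|%:R * p%:R) ->
  (forall y, y \in S -> ok y -> lsum l Q (rel y x) <= G * L) ->
  (#|[set y in S | ~~ ok y]| * Q ^ 2 <= d * #|S|)%N ->
  lsum l Q (covered rel s x) <= M ->
  (0 < Y)%N -> M <= kappa / 4 * L * Y%:R -> Y.+1%:R <= kappa / 4 * L ->
  d%:R * G <= c * kappa / 4 * Q%:R ->
  c * kappa / 4 * L * #|S|%:R <=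
    \sum_(y in S) Num.min (lsum l Q (fun p => rel y x p && ~~ covered rel s x p)) (G * L).
Proof.
move=> L ar c0 hgood hrel hok hnok hM Y0 hMY hY hQ.
have l0 := ar_ge0 ar; have L0 : 0 <= L := ar_L_ge0 ar.
have G0 : 0 <= G by apply: le_trans (ar_G ar).
have QR : 0 < Q%:R :> R by rewrite ltr0n (ar_Q ar).
pose nc p := good p && ~~ covered rel s x p.
have h1 : kappa / 2 * L <= wsum l Q nc.
  have : wsum l Q good <= wsum l Q nc + wsum l Q (covered rel s x).
    by apply: wsum_le_wsumU => // p _; rewrite /nc => ->; rewrite /= orNb.
  move: hgood.
  have := wsum_lsum l0 Q (covered rel s x) (ar_le ar) Y0.
  have YR : 0 < Y%:R :> R by rewrite ltr0n.
  have : lsum l Q (covered rel s x) / Y%:R <= kappa / 4 * L.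
    by rewrite ler_pdivrMr // (le_trans hM).
  by move: hY; lra.
set nok := #|[set y in S | ~~ ok y]| in hnok *.
have h2 : c * #|S|%:R * wsum l Q nc - nok%:R * lsum l Q predT <=
    \sum_(y in [set y in S | ok y]) lsum l Q (fun p => rel y x p && ~~ covered rel s x p).
  rewrite sum_lsumE wsumE lsumE !mulr_sumr -sumrB; apply: ler_sum => p pp.
  have lp := l0 p pp; have pR := prime_natr_gt0 R pp.
  have [ncp|_] := boolP (nc p); last first.
    rewrite mulr0 mulr0 sub0r mulr1; apply: (@le_trans _ _ 0); last exact: mulr_ge0.
    by rewrite oppr_le0 mulr_ge0.
  have /andP[gp cp] := ncp.
  have hc : (#|[set y in S | rel y x p]| <=
     #|[set y in [set y in S | ok y] | rel y x p && ~~ covered rel s x p]| + nok)%N.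
    apply: leq_trans (leq_card_setU _ _); apply: subset_leq_card; apply/subsetP => y.
    by rewrite !inE cp => /andP[-> ->] /=; case: (ok y).
  have hr := hrel p pp gp.
  have hp : c * #|S|%:R / p%:R <= #|[set y in S | rel y x p]|%:R by rewrite ler_pdivrMr.
  move: hc; rewrite -(ler_nat R) natrD => hc.
  have := ler_wpM2l lp (le_trans hp hc).
  rewrite /= !mulr1; lra.
have h3 : \sum_(y in [set y in S | ok y]) lsum l Q (fun p => rel y x p && ~~ covered rel s x p)
    <= \sum_(y in S) Num.min (lsum l Q (fun p => rel y x p && ~~ covered rel s x p)) (G * L).
  rewrite [leLHS]big_mkcond [leRHS]big_mkcond /=; apply: ler_sum => y _; rewrite inE.
  case yS: (y \in S) => //=; case oky: (ok y); rewrite le_min.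
    rewrite lexx /=; apply: le_trans (hok y yS oky).
    by apply: (lsum_le l0) => p _ /andP[].
  by rewrite lsum_ge0 //= mulr_ge0.
apply: le_trans h3; apply: le_trans h2.
have h4 : nok%:R * Q%:R ^+ 2 <= d%:R * #|S|%:R :> R by rewrite -natrX -!natrM ler_nat.
have h5 : nok%:R * lsum l Q predT <= c * kappa / 4 * L * #|S|%:R.
  apply: (@le_trans _ _ (nok%:R * (G * Q%:R * L))); first by rewrite ler_wpM2l // (ar_tot ar).
  rewrite -(ler_pM2r QR).
  apply: (@le_trans _ _ (d%:R * #|S|%:R * (G * L))).
    have := ler_wpM2r (mulr_ge0 G0 L0) h4; lra.
  have := ler_wpM2r (mulr_ge0 L0 (ler0n R #|S|)) hQ; lra.
have := ler_wpM2l (mulr_ge0 c0 (ler0n R #|S|)) h1; lra.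
Qed.

(** * Characteristic sets *)

Section Typical.
Variables (R : realFieldType) (l : nat -> R) (G : R) (N Q d k : nat).
Variables (iota : gridpt d N -> 'I_d) (S : {set gridpt d N}) (alpha alpha' kappa K K3 c : R).
Let L := wsum l Q predT.

Definition few p := (nres p S)%:R <= alpha * p%:R ^+ k.+1.

Definition large x := (N ^ k * Q ^ (2 * d + 2 + k) <= #|sec iota S x| * N)%N.

(** With [large], this makes the section subject to the induction hypothesis, with [alpha'] and half
    of [kappa]. *)
Definition rich x :=
  kappa / 2 * L <= wsum l Q (fun p => (nres p (sec iota S x))%:R <= alpha' * p%:R ^+ k).

Definition slice_ok x p := #|slice iota p S x|%:R * p%:R <= K * #|S|%:R.

Definition sec_ok x p :=
  #|cls p (sec iota S x) x|%:R * p%:R ^+ k <= K3 * #|sec iota S x|%:R.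

Definition regular p := [set x in S | [&& large x && rich x, slice_ok x p & sec_ok x p]].

Definition heavy p := [set x in regular p | c * #|S|%:R <= #|cls p (regular p) x|%:R * p%:R ^+ k.+1].

Definition typical :=
  [set x in S | kappa / 2 * L <= wsum l Q (fun p => few p && (x \in heavy p))].

Lemma regular_sub p : regular p \subset S.
Proof. by apply/subsetP => x; rewrite inE => /andP[]. Qed.

(** Five defects are possible: a small section, a section with too many classes, an overfull slice,
    an overfull class in the section, and a light class. Each has total weight at most
    [delta * L * #|S|], while an atypical point collects at least [kappa / 2 * L] in all; hence the
    factor 10. *)
Lemma card_atypical (delta : R) :
  arith l G N Q -> 0 < L -> 0 < delta -> 0 < kappa -> 0 < K -> 0 < alpha' -> 0 <= c ->
  (forall u, (#|[set z in S | lab iota z == u]| * Q ^ 2 <= #|S|)%N) ->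
  (#|[set x in S | #|sec iota S x| * N < N ^ k * Q ^ (2 * d + 2 + k)]| * Q <= 2 * d * #|S|)%N ->
  2 * d%:R <= delta * Q%:R -> 2 * G / K <= delta * kappa / 4 -> 2 * G / K <= delta ->
  d%:R * alpha * K <= delta * kappa / 4 * alpha' -> alpha * c <= delta ->
  (forall x, x \in S -> large x ->
     \sum_(z in sec iota S x) wsum l Q (fun p => K3 * #|sec iota S x|%:R
           < #|cls p (sec iota S x) z|%:R * p%:R ^+ k) <= delta * L * #|sec iota S x|%:R) ->
  kappa * L <= wsum l Q few ->
  kappa * #|S :\: typical|%:R <= 10 * delta * #|S|%:R.
Proof.
move=> ar L0 delta0 kappa0 K0 alpha'0 c0 fib small hQ hK1 hK2 hal hc hsec hfew.
have l0 := ar_ge0 ar; set s := #|S|%:R.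
have s0 : 0 <= s by [].
have QR : 0 < Q%:R :> R by rewrite ltr0n (ar_Q ar).
pose mass (P : gridpt d N -> pred nat) := \sum_(x in S) wsum l Q (P x).
have b1 : mass (fun x _ => ~~ large x) <= delta * L * s.
  rewrite /mass sum_wsum_if -/L [delta * L]mulrC -mulrA; apply: ler_wpM2l; first exact: ltW.
  have -> : [set x in S | ~~ large x] =
      [set x in S | #|sec iota S x| * N < N ^ k * Q ^ (2 * d + 2 + k)]%N.
    by apply/setP => x; rewrite !inE -ltnNge.
  move: small; rewrite -(ler_nat R) !natrM -/s => small.
  rewrite -(ler_pM2r QR); apply: le_trans small _.
  by have := ler_wpM2r s0 hQ; lra.
have b3' : mass (fun x p => ~~ slice_ok x p) <= 2 * G / K * L * s.
  apply: le_trans (slice_mass ar fib K0); apply: ler_sum => x _.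
  by apply: (wsum_le l0) => p _; rewrite -ltNge.
have Ls0 : 0 <= L * s by rewrite mulr_ge0 // ltW.
have b3 : mass (fun x p => ~~ slice_ok x p) <= delta * L * s.
  by have := ler_wpM2r Ls0 hK2; lra.
have b4 : mass (fun x p => large x && ~~ sec_ok x p) <= delta * L * s.
  apply: (sum_le_blocks (lab := lab iota)) => x xS; rewrite -/(sec iota S x).
  have [lx|nlx] := boolP (large x); last first.
    rewrite big1; first by rewrite !mulr_ge0 // ltW.
    move=> z zx; apply: wsum_pred0 => p.
    have -> : large z = large x by rewrite /large (sec_eq zx).
    by rewrite (negbTE nlx).
  apply: le_trans (hsec x xS lx); apply: ler_sum => z zx.
  by apply: (wsum_le l0) => p _; rewrite /sec_ok (sec_eq zx) -ltNge => /andP[].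
pose poor x p := few p && ~~ ((nres p (sec iota S x))%:R <= alpha' * p%:R ^+ k).
have b2' : mass poor <= delta * kappa / 2 * L * s.
  apply: (@le_trans _ _ (mass (fun x p => poor x p && slice_ok x p)
                         + mass (fun x p => ~~ slice_ok x p))).
    rewrite /mass -big_split /=; apply: ler_sum => x _; apply: (wsum_le_wsumU l0) => p _ ->.
    by case: (slice_ok x p).
  have : mass (fun x p => poor x p && slice_ok x p) <= delta * kappa / 4 * s * L.
    apply: (sum_wsum_le l0) => p pp.
    have [fp|nfp] := boolP (few p); last first.
      have -> : [set x in S | poor x p && slice_ok x p] = set0.
        by apply/setP => x; rewrite !inE /poor (negbTE nfp) andbF.
      by rewrite cards0 mulr_ge0 // ltW // divr_gt0 // mulr_gt0.
    have := card_rich_sections iota alpha' (prime_gt0 pp) (ltW K0) fp.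
    rewrite -/s => h; rewrite -(ler_pM2r alpha'0).
    apply: le_trans (_ : d%:R * alpha * K * s <= _); last first.
      by have := ler_wpM2r s0 hal; lra.
    apply: le_trans h; apply: ler_wpM2r; first exact: ltW.
    rewrite ler_nat.
    apply: subset_leq_card; apply/subsetP => x; rewrite !inE /poor => /and3P[-> /andP[_ h1] h2].
    by rewrite ltNge h1.
  have := ler_wpM2r Ls0 hK1; lra.
(* If [x] is not rich, its section has too many classes for a weight [kappa / 2 * L] of the primes
   modulo which [S] has few; Markov's inequality then applies to [b2']. *)
have b2 : #|[set x in S | ~~ rich x]|%:R <= delta * s.
  have kL : 0 < kappa / 2 * L by rewrite mulr_gt0 // divr_gt0.
  rewrite -(ler_pM2l kL).
  apply: le_trans (_ : delta * kappa / 2 * L * s <= _); last by lra.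
  apply: (markov_card (f := fun x => wsum l Q (poor x))) => // x xS; first exact: wsum_ge0.
  rewrite /rich -ltNge => nr.
  have : wsum l Q few <= wsum l Q (poor x) +
      wsum l Q (fun p => (nres p (sec iota S x))%:R <= alpha' * p%:R ^+ k).
    by apply: (wsum_le_wsumU l0) => p _ fp; rewrite /poor fp /= orNb.
  by move: hfew nr; lra.
have b2L : mass (fun x _ => ~~ rich x) <= delta * L * s.
  rewrite /mass sum_wsum_if -/L; have := ler_wpM2l (ltW L0) b2; lra.
(* Light classes have fewer than [c * s / p ^ k.+1] regular points, and [few p] leaves at most
   [alpha * p ^ k.+1] classes. *)
have b5 : mass (fun x p => few p && ((x \in regular p) && (x \notin heavy p))) <= delta * s * L.
  apply: (sum_wsum_le l0) => p pp.
  have [fp|nfp] := boolP (few p); last first.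
    set Y := [set x in S | _].
    have -> : Y = set0 by apply/setP => x; rewrite !inE /= andbF.
    by rewrite cards0 mulr_ge0 // ltW.
  have pk : 0 < p%:R ^+ k.+1 :> R by rewrite exprn_gt0 // prime_natr_gt0.
  set Y := [set x in S | _].
  have YS : Y \subset S by apply/subsetP => x; rewrite inE => /andP[].
  have t0 : 0 <= c * s / p%:R ^+ k.+1 by rewrite divr_ge0 ?mulr_ge0 // ltW.
  apply: le_trans (card_le_nres t0 YS _) _.
    move=> x; rewrite inE => /and4P[xS _ xr]; rewrite inE xr /= -ltNge => h.
    rewrite ler_pdivlMr //; apply: le_trans (ltW h).
    apply: ler_wpM2r; first exact: ltW.
    rewrite ler_nat; apply: subset_leq_card; apply/subsetP => y.
    rewrite inE => /andP[yY yx]; rewrite inE yx andbT.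
    by rewrite inE in yY; case/and4P: yY.
  apply: le_trans (ler_wpM2r t0 fp) _.
  rewrite (_ : alpha * _ * _ = alpha * c * s); last by field; rewrite gt_eqF // prime_natr_gt0.
  exact: ler_wpM2r.
have kL : 0 < L / 2 by rewrite divr_gt0.
rewrite -(ler_pM2l kL) mulrA.
have -> : S :\: typical = [set x in S | x \notin typical] by apply/setP => x; rewrite !inE andbC.
apply: (@le_trans _ _ (5 * (delta * L * s))); last by rewrite /s; lra.
apply: (markov_card (f := fun x => wsum l Q (fun p => few p && (x \notin heavy p)))).
- by move=> x _; apply: wsum_ge0.
- apply: (@le_trans _ _ (\sum_(x in S) (wsum l Q (fun=> ~~ large x) + (wsum l Q (fun=> ~~ rich x)
    + (wsum l Q (fun p => ~~ slice_ok x p) + (wsum l Q (fun p => large x && ~~ sec_ok x p)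
    + wsum l Q (fun p => few p && ((x \in regular p) && (x \notin heavy p))))))))).
    apply: ler_sum => x xS.
    pose rest p := [|| ~~ rich x, ~~ slice_ok x p, large x && ~~ sec_ok x p |
      few p && ((x \in regular p) && (x \notin heavy p))].
    apply: (@le_trans _ _ (wsum l Q (fun=> ~~ large x) + wsum l Q rest)).
      apply: (wsum_le_wsumU l0) => p _ /andP[fp xh].
      rewrite /rest fp xh andbT [x \in regular p]inE xS /= /sec_ok.
      by case: (large x); case: (rich x); case: (slice_ok x p); case: (_ <= _ :> R).
    rewrite lerD2l; apply: le_trans (wsumU l0 _ _ _) _; rewrite lerD2l.
    apply: le_trans (wsumU l0 _ _ _) _; rewrite lerD2l; exact: wsumU.
  rewrite !big_split /=; rewrite /mass in b1 b2L b3 b4 b5; lra.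
- move=> x xS; rewrite inE xS /= -ltNge => h.
  have : wsum l Q few <= wsum l Q (fun p => few p && (x \in heavy p)) +
      wsum l Q (fun p => few p && (x \notin heavy p)).
    by apply: (wsum_le_wsumU l0) => p _ ->; rewrite /= orbN.
  by move: h hfew; lra.
Qed.

End Typical.

Definition sieve_closed (R : realFieldType) (l : nat -> R) (d N Q : nat) (B : R)
    (Z : {set gridpt d N}) :=
  forall x, B * wsum l Q predT < lsum l Q (fun p => [exists z in Z, red p z == red p x]) ->
    x \in Z.

(** [Z] ranges over all closed sets and not over zero sets, which keeps polynomials out of the
    induction: one [Z] is tested on all sections at once. *)
Definition characteristic (R : realFieldType) (l : nat -> R) (d N Q : nat) (B eta : R)
    (S A : {set gridpt d N}) :=
  forall Z, sieve_closed l Q B Z -> A \subset Z -> #|S :\: Z|%:R <= eta * #|S|%:R.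

Section Step.
Variables (R : realFieldType) (l : nat -> R) (G : R) (N Q d k : nat).
Variables (iota : gridpt d N -> 'I_d) (S : {set gridpt d N}) (alpha alpha' kappa K K3 c cr : R).
Implicit Types (x y z : gridpt d N) (p : nat).
Let L := wsum l Q predT.
Let few := few k S alpha.
Let regular := regular l Q k iota S alpha' kappa K K3.
Let heavy := heavy l Q k iota S alpha' kappa K K3 c.
Let typical := typical l Q k iota S alpha alpha' kappa K K3 c.

(** A single point congruent to [x] would not do: a closed set contains only most of the section, so
    the section must have enough points in the class for missing all of them to be rare. *)
Definition meets y x p := [&& few p, x \in heavy p &
  cr * #|sec iota S y|%:R <= #|cls p (regular p :&: sec iota S y) x|%:R * p%:R ^+ k].

Hypotheses (ar : arith l G N Q) (L_gt0 : 0 < L) (d_gt0 : (0 < d)%N).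
Hypotheses (c_gt0 : 0 < c) (K_gt0 : 0 < K) (K3_gt0 : 0 < K3).
Hypothesis fib : forall u, (#|[set z in S | lab iota z == u]| * Q ^ 2 <= #|S|)%N.
Hypothesis crE : cr = c / (2 * d%:R * K).

Lemma cr_gt0 : 0 < cr.
Proof. by rewrite crE divr_gt0 // !mulr_gt0 // ltr0n. Qed.

Lemma regular_slice p x : x \in regular p -> #|slice iota p S x|%:R * p%:R <= K * #|S|%:R.
Proof. by rewrite inE => /and4P[]. Qed.

Lemma regular_sec p x : x \in regular p ->
  #|cls p (sec iota S x) x|%:R * p%:R ^+ k <= K3 * #|sec iota S x|%:R.
Proof. by rewrite inE => /and4P[]. Qed.

Lemma meets_witness y x p : y \in S -> meets y x p ->
  exists w, [/\ w \in regular p, w \in sec iota S y & red p w = red p x].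
Proof.
move=> yS /and3P[_ _ h].
have [e|[w]] := set_0Vmem (cls p (regular p :&: sec iota S y) x).
  move: h; rewrite e cards0 mul0r leNgt mulr_gt0 ?cr_gt0 // ltr0n.
  by apply/card_gt0P; exists y; apply: mem_sec.
by rewrite !inE => /andP[/andP[h1 h2] /eqP h3]; exists w; rewrite !inE.
Qed.

(** Meeting [x] modulo [p] forces a congruence between [x] and the fixed coordinate of the section,
    to which [ar_pair] applies. *)
Lemma lsum_meets y x : y \in S -> y (iota y) != x (iota y) ->
  lsum l Q (meets y x) <= G * L.
Proof.
move=> yS yx.
have yx' : (y (iota y) : nat) != x (iota y) by [].
apply: le_trans (ar_pair ar (leq_ord _) (leq_ord _) yx').
apply: (lsum_le (ar_ge0 ar)) => p pp /(meets_witness yS)[w [_ wy /eqP/red_eqP wx]].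
move: wy; rewrite inE => /andP[_ /eqP[e1 e2]].
by rewrite -e2 e1; apply/eqP.
Qed.

Lemma card_sharing x : (#|[set y in S | ~~ (y (iota y) != x (iota y))]| * Q ^ 2 <= d * #|S|)%N.
Proof.
rewrite (card_fibres iota) big_distrl /= -[X in (_ <= X * _)%N](card_ord d) -sum_nat_const.
apply: leq_sum => j _; apply: leq_trans (fib (j, x j)).
rewrite leq_mul2r; apply/orP; right; apply: subset_leq_card; apply/subsetP => y.
by rewrite !inE negbK => /andP[/andP[-> /eqP e1] /eqP e2] /=; rewrite /lab e1 e2 -e2 eqxx.
Qed.

Lemma card_meets x p : prime p -> few p && (x \in heavy p) ->
  c / (2 * K3) * #|S|%:R <= #|[set y in S | meets y x p]|%:R * p%:R.
Proof.
move=> pp /andP[fp xh].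
have hx : c * #|S|%:R <= #|cls p (regular p) x|%:R * p%:R ^+ k.+1.
  by move: xh; rewrite inE => /andP[].
have := card_covering K_gt0 K3_gt0 (regular_sub l Q k iota S alpha' kappa K K3 p)
  (@regular_slice p) (@regular_sec p) (ltW c_gt0) d_gt0 hx.
rewrite -crE; congr (_ <= _%:R * _); apply: eq_card => y.
by rewrite !inE /meets fp xh.
Qed.

Lemma typical_sub : typical \subset S.
Proof. by apply/subsetP => x; rewrite inE => /andP[]. Qed.

(** The target is twice the threshold [B * L] of [sieve_closed], so that half of the covering may be
    lost to classes that a closed set misses. *)
Lemma meets_covering (B : nat) (rho : R) (n Y : nat) :
  (0 < B)%N -> 0 < rho -> 0 < kappa -> (0 < Y)%N ->
  2 * B%:R <= kappa / 8 * Y%:R -> Y.+1%:R <= kappa / 8 * L ->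
  d%:R * G <= c / (2 * K3) * kappa / 8 * Q%:R ->
  2 * B%:R + G < rho * (c / (2 * K3) * kappa / 8) * n%:R ->
  exists s : seq (gridpt d N), [/\ (size s <= n)%N, {subset s <= S} &
    #|[set x in typical | lsum l Q (covered meets s x) < 2 * B%:R * L]|%:R <= rho * #|S|%:R].
Proof.
move=> B0 rho0 kappa0 Y0 hY1 hY2 hQ hn.
have c20 : 0 < c / (2 * K3) by rewrite divr_gt0 // mulr_gt0.
have G0 : 0 <= G by apply: le_trans (ar_G ar).
apply: (@greedy_covering _ l Q _ S meets (ar_ge0 ar) typical (2 * B%:R * L) (G * L)
         (c / (2 * K3) * kappa / 8 * L) rho n).
- by rewrite !mulr_ge0 // ltW.
- by rewrite mulr_ge0 // ltW.
- exact: ltW.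
- by rewrite mulr_gt0 // divr_gt0 // mulr_gt0.
- exact: typical_sub.
- move=> s x xt hM.
  have := @covering_gain R l G N Q d S meets s x (fun p => few p && (x \in heavy p))
    (fun y => y (iota y) != x (iota y)) (kappa / 2) (c / (2 * K3)) (2 * B%:R * L) Y ar (ltW c20).
  rewrite -/L => gain; apply: le_trans (gain _ _ _ _ _ _ _ _ _) => {gain} //.
  + by rewrite le_eqVlt; apply/orP; left; apply/eqP; field; rewrite gt_eqF.
  + by move: xt; rewrite inE => /andP[].
  + by move=> p pp; apply: card_meets.
  + by move=> y yS; apply: lsum_meets.
  + exact: card_sharing.
  + exact: ltW.
  + by have := ler_wpM2l (ltW L_gt0) hY1; lra.
  + by lra.
  + by lra.
- by have := hn; rewrite -(ltr_pM2r L_gt0); lra.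
Qed.

Lemma card_meets_missed (Z : {set gridpt d N}) y p eta : prime p -> y \in S ->
  (large Q k iota S y -> rich l Q k iota S alpha' kappa y ->
   #|sec iota S y :\: Z|%:R <= eta * #|sec iota S y|%:R) -> 0 <= eta ->
  #|[set x in S | meets y x p && ~~ [exists z in Z, red p z == red p x]]|%:R
   <= eta * (d%:R * (K * K3)) / cr * #|S|%:R / p%:R.
Proof.
move=> pp yS hZ eta0; set E := [set x in S | _].
have cr0 := cr_gt0; have p0 := prime_natr_gt0 R pp.
(* If the section of [y] meets any point, it contains a regular one, hence is large and rich, and
   [hZ] applies. So only large and rich sections need a characteristic set. *)
have [->|[x0]] := set_0Vmem E.
  by rewrite cards0 !mulr_ge0 ?invr_ge0 // ltW.
rewrite inE => /and3P[_ /(meets_witness yS)[w [wr wy _]] _].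
have es := sec_eq wy.
have /andP[ly ry] : large Q k iota S y && rich l Q k iota S alpha' kappa y.
  by move: wr; rewrite inE => /and3P[_ h _]; move: h; rewrite /large /rich es.
have hZy := hZ ly ry.
have := card_missed (prime_gt0 pp) K_gt0 K3_gt0 (regular_sub l Q k iota S alpha' kappa K K3 p)
  (@regular_slice p) (@regular_sec p) (ltW cr0) yS hZy.
set F := [set x in _ | _] => hF.
have EF : E \subset F.
  apply/subsetP => x; rewrite inE => /and3P[_ /and3P[_ xh xm] xz].
  by rewrite inE xm xz; move: xh; rewrite inE => /andP[->].
have EF' : #|E|%:R <= #|F|%:R :> R by rewrite ler_nat subset_leq_card.
rewrite ler_pdivlMr // -(ler_pM2l cr0).
rewrite [leRHS](_ : _ = eta * (d%:R * (K * K3)) * #|S|%:R); last first.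
  by field; rewrite gt_eqF.
apply: le_trans hF; rewrite mulrA ler_pM2r // ler_pM2l //.
Qed.

(** Let [x] be outside [Z] and covered up to [2 * B * L]. As [Z] is closed, it agrees with [x] up to
    at most [B * L], so [x] is met by sections of [s], with weight at least [B * L], modulo primes
    where [Z] misses its class. [card_meets_missed] bounds the sum of these weights over [x]. *)
Lemma characteristic_union (B n : nat) (eta eta' : R) (A : gridpt d N -> {set gridpt d N})
    (s : seq (gridpt d N)) :
  (0 < B)%N -> 0 <= eta' -> (size s <= n)%N -> {subset s <= S} ->
  (forall y, y \in S -> large Q k iota S y -> rich l Q k iota S alpha' kappa y ->
     characteristic l Q B%:R eta' (sec iota S y) (A y)) ->
  #|[set x in typical | lsum l Q (covered meets s x) < 2 * B%:R * L]|%:R <= eta / 4 * #|S|%:R ->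
  #|S :\: typical|%:R <= eta / 4 * #|S|%:R ->
  n%:R * (eta' * (d%:R * (K * K3)) / cr) <= eta / 4 * B%:R ->
  characteristic l Q B%:R eta S
    (\bigcup_(y <- s | large Q k iota S y && rich l Q k iota S alpha' kappa y) A y).
Proof.
move=> B0 eta'0 sn sS hA hU hT hn Z Zc AZ.
have l0 := ar_ge0 ar.
have BR : 0 < B%:R :> R by rewrite ltr0n.
pose U := [set x in typical | lsum l Q (covered meets s x) < 2 * B%:R * L].
pose F := [set x in S | (x \notin Z) && (2 * B%:R * L <= lsum l Q (covered meets s x))].
have cover : (#|S :\: Z| <= #|S :\: typical| + #|U| + #|F|)%N.
  apply: leq_trans (leq_trans (leq_card_setU _ _) (leq_add (leq_card_setU _ _) (leqnn _))).
  apply: subset_leq_card; apply/subsetP => x; rewrite in_setD => /andP[xZ xS].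
  rewrite !in_setU in_setD xS andbT [x \in U]inE [x \in F]inE xS xZ /=.
  by case: (x \in typical); rewrite // ltNge; case: (_ <= _).
pose miss y x p := meets y x p && ~~ [exists z in Z, red p z == red p x].
set D := eta' * (d%:R * (K * K3)) / cr in hn *.
have D0 : 0 <= D by rewrite divr_ge0 ?(ltW cr_gt0) // !mulr_ge0 // ltW.
have hmiss y : y \in s -> \sum_(x in S) lsum l Q (miss y x) <= D * #|S|%:R * L.
  move=> ys; rewrite sum_lsumE /L wsumE mulr_sumr; apply: ler_sum => p pp.
  have := @card_meets_missed Z y p eta' pp (sS y ys) _ eta'0.
  have hZ : large Q k iota S y -> rich l Q k iota S alpha' kappa y ->
      #|sec iota S y :\: Z|%:R <= eta' * #|sec iota S y|%:R.
    move=> ly ry; apply: (hA y (sS y ys) ly ry Z Zc).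
    by apply: subset_trans AZ; rewrite (big_rem y ys) /= ly ry subsetUl.
  move=> /(_ hZ) h; have := ler_wpM2l (l0 p pp) h.
  rewrite /miss /D /= mulr1; lra.
have hF : B%:R * L * #|F|%:R <= n%:R * (D * #|S|%:R * L).
  apply: (@le_trans _ _ (\sum_(x in S) \sum_(y <- s) lsum l Q (miss y x))).
    rewrite -sum1dep_card natr_sum mulr_sumr big_mkcondr /=; apply: ler_sum => x xS.
    case: ifP => [/andP[xZ hx]|_]; last by apply: sumr_ge0 => y _; apply: lsum_ge0.
    have hxZ : lsum l Q (fun p => [exists z in Z, red p z == red p x]) <= B%:R * L.
      by rewrite leNgt; apply: contra xZ => /Zc.
    have key : lsum l Q (covered meets s x) <=
        lsum l Q (fun p => [exists z in Z, red p z == red p x]) + \sum_(y <- s) lsum l Q (miss y x).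
      under [X in _ + X]eq_bigr => y _ do rewrite lsumE.
      rewrite exchange_big /= !lsumE -big_split /=; apply: ler_sum => p pp.
      rewrite -mulr_sumr -mulrDr; apply: ler_wpM2l; first exact: l0.
      have [ez|nz] := boolP [exists z in Z, red p z == red p x].
        apply: (@le_trans _ _ 1); first by case: (covered _ _ _ _).
        by rewrite lerDl; apply: sumr_ge0 => y _.
      rewrite add0r; case: (boolP (covered meets s x p)) => [/hasP[y ys yx]|_]; last first.
        by apply: sumr_ge0 => y _.
      rewrite (big_rem y) //= /miss yx nz lerDl; exact: sumr_ge0.
    rewrite mulr1; lra.
  rewrite exchange_big /=.
  apply: (@le_trans _ _ (\sum_(y <- s) D * #|S|%:R * L)).
    rewrite big_seq [leRHS]big_seq; apply: ler_sum => y ys.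
    exact: hmiss.
  rewrite big_const_seq count_predT iter_addr_0 -[leLHS]mulr_natl ler_wpM2r ?ler_nat //.
  exact: mulr_ge0 (mulr_ge0 D0 (ler0n R _)) (ltW L_gt0).
have hF' : #|F|%:R <= eta / 4 * #|S|%:R.
  have BL : 0 < B%:R * L by rewrite mulr_gt0.
  rewrite -(ler_pM2l BL); apply: le_trans hF _.
  have := ler_wpM2r (mulr_ge0 (ltW L_gt0) (ler0n R #|S|)) hn; lra.
move: cover; rewrite -(ler_nat R) !natrD => cover.
apply: le_trans cover _.
have e0 : 0 <= eta * #|S|%:R by have := le_trans (ler0n R _) hT; lra.
rewrite -/U in hU; move: hT hF' hU; lra.
Qed.

End Step.

(** The case [k = 0], by counting congruent pairs. Modulo a prime with at most [alpha] classes, at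
    least half of the points lie in classes of more than [#|S| / (2 * alpha)] points, whereas two
    distinct points agree for at most a proportion [kappa / (8 * alpha)] of the primes. *)
Lemma card_few_classes (R : realFieldType) (l : nat -> R) (G : R) (N Q d Y : nat)
    (S : {set gridpt d N}) (alpha kappa : R) :
  let L := wsum l Q predT in
  arith l G N Q -> 0 < L -> 0 < alpha -> 0 < kappa -> (0 < Y)%N ->
  16 * alpha * G <= kappa * Y%:R -> 16 * alpha * Y.+1%:R <= kappa * L ->
  kappa * L <= wsum l Q (fun p => (nres p S)%:R <= alpha) ->
  kappa * #|S|%:R <= 8 * alpha.
Proof.
move=> L ar L0 al0 ka0 Y0 hY1 hY2 hk; have l0 := ar_ge0 ar.
set s := #|S|%:R; have s0 : 0 <= s by [].
have [e|S0] := eqVneq S set0; first by rewrite /s e cards0 mulr0 mulr_ge0 // ltW.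
have sp : 0 < s by rewrite ltr0n card_gt0.
have YR : 0 < Y%:R :> R by rewrite ltr0n.
have ler_n (m n : nat) : (m <= n)%N -> m%:R <= n%:R :> R by rewrite ler_nat.
pose tot := \sum_(x in S) \sum_(y in S) wsum l Q (fun p => red p y == red p x).
have upper : tot <= s * L + s * (s * (kappa / (8 * alpha) * L)).
  apply: (@le_trans _ _ (\sum_(x in S) (L + s * (kappa / (8 * alpha) * L)))); last first.
    by rewrite sumr_const -[leLHS]mulr_natl -/s mulrDr.
  apply: ler_sum => x xS; rewrite (bigD1 x) //=; apply: lerD; first exact: (wsum_le l0).
  apply: (@le_trans _ _ (\sum_(y in S) (kappa / (8 * alpha) * L))); last first.
    by rewrite sumr_const -[leLHS]mulr_natl -/s.
  rewrite big_mkcondr /=; apply: ler_sum => y yS.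
  have r0 : 0 <= kappa / (8 * alpha) * L by rewrite mulr_ge0 ?divr_ge0 ?mulr_ge0 // ltW.
  case: ifP => // yx; have := ar_pairpt ar yx => hp.
  apply: le_trans (wsum_lsum l0 Q _ (ar_le ar) Y0) _.
  have -> : kappa / (8 * alpha) * L = kappa * L / (16 * alpha) + kappa * L / (16 * alpha).
    by field; rewrite gt_eqF.
  have a16 : 0 < 16 * alpha by rewrite mulr_gt0.
  apply: lerD; first by rewrite ler_pdivlMr // mulrC.
  rewrite ler_pdivrMr // mulrAC ler_pdivlMr // -/L in hp *.
  have := ler_wpM2r (ltW L0) hY1; have := ler_wpM2r (ltW a16) hp; lra.
have lower : kappa * L * (s / 2 * (s / (2 * alpha))) <= tot.
  have -> : tot = \sum_(p < Q.+1 | prime p) l p / p%:R * (\sum_(x in S) #|cls p S x|)%:R.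
    rewrite /tot; under eq_bigr => x _ do rewrite sum_wsumE.
    rewrite exchange_big /=; apply: eq_bigr => p _.
    by rewrite natr_sum mulr_sumr.
  apply: (@le_trans _ _ (wsum l Q (fun p => (nres p S)%:R <= alpha) * (s / 2 * (s / (2 * alpha))))).
    by rewrite ler_wpM2r // mulr_ge0 // divr_ge0 // mulr_ge0 // ltW.
  rewrite wsumE mulr_suml; apply: ler_sum => p pp.
  have w0 := weight_ge0 l0 pp.
  have [hn|_] := boolP ((nres p S)%:R <= alpha); last first.
    by rewrite mulr0 mul0r mulr_ge0.
  rewrite mulr1; apply: ler_wpM2l => //.
  pose t := s / (2 * alpha).
  have t0 : 0 <= t by rewrite divr_ge0 // mulr_ge0 // ltW.
  pose A := [set x in S | #|cls p S x|%:R <= t].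
  have AS : A \subset S by apply/subsetP => x; rewrite inE => /andP[].
  have hA : #|A|%:R <= s / 2.
    apply: le_trans (card_le_nres t0 AS _) _.
      move=> x; rewrite inE => /andP[_]; apply: le_trans; apply: ler_n.
      apply: subset_leq_card; apply/subsetP => y; rewrite !inE => /andP[/andP[-> _] ->].
      by [].
    apply: le_trans (ler_wpM2r t0 hn) _; rewrite le_eqVlt; apply/orP; left; apply/eqP.
    by rewrite /t; field; rewrite gt_eqF.
  have hB : s / 2 <= #|S :\: A|%:R.
    have : s = #|A|%:R + #|S :\: A|%:R.
      by rewrite /s -(cardsID A S) (setIidPr AS) natrD.
    lra.
  rewrite -/t natr_sum; apply: (@le_trans _ _ (\sum_(x in S :\: A) t)).
    by rewrite sumr_const -[leRHS]mulr_natl ler_wpM2r.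
  rewrite [leRHS](bigID (mem A)) /= -[leLHS]add0r; apply: lerD; first exact: sumr_ge0.
  rewrite [leLHS](eq_bigl (fun x => (x \in S) && (x \notin A))); last by move=> x; rewrite inE andbC.
  apply: ler_sum => x /andP[xS]; rewrite inE xS /= -ltNge; exact: ltW.
have := le_trans lower upper.
have -> : kappa * L * (s / 2 * (s / (2 * alpha))) = (s * L / (8 * alpha)) * (2 * (kappa * s)).
  by field; rewrite gt_eqF.
have -> : s * L + s * (s * (kappa / (8 * alpha) * L)) = (s * L / (8 * alpha)) * (8 * alpha + kappa * s).
  by field; rewrite gt_eqF.
rewrite ler_pM2l; first lra.
by rewrite divr_gt0 ?mulr_gt0.
Qed.

(* [C] must not depend on [B], which is later taken proportional to the degree of the
   interpolating polynomial. *)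
Lemma characteristic_set_exists (R : archiRealFieldType) (l : nat -> R) (d : nat) (j0 : 'I_d)
    (G : R) (k : nat) :
  1 <= G -> forall alpha kappa eta : R, 0 < alpha -> 0 < kappa -> 0 < eta ->
  exists C : nat, forall B : nat, (0 < B)%N -> exists q0 : R,
    forall N Q (S : {set gridpt d N}), arith l G N Q -> q0 <= wsum l Q predT ->
      (N ^ k * Q ^ (2 * d + 2 + k) <= #|S| * N)%N ->
      kappa * wsum l Q predT <= wsum l Q (fun p => (nres p S)%:R <= alpha * p%:R ^+ k) ->
      exists A : {set gridpt d N}, [/\ A \subset S, (#|A| <= C * B ^ k)%N &
        characteristic l Q B%:R eta S A].
Proof.
move=> G1; have G0 : 0 < G by apply: lt_le_trans G1.
have d0 : (0 < d)%N by case: d j0 => // -[].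
have dR : 0 < d%:R :> R by rewrite ltr0n.
pose ub (x : R) : nat := (Num.Def.archi_bound x).+1.
have ubPt (x : R) : 0 <= x -> x < (ub x)%:R.
  by move=> x0; apply: lt_le_trans (archi_boundP x0) _; rewrite ler_nat.
have ubP (x : R) : 0 <= x -> x <= (ub x)%:R by move=> /ubPt /ltW.
have ub0 x : (0 < ub x)%N by [].
elim: k => [|k IH] alpha kappa eta al0 ka0 eta0.
  exists (ub (8 * alpha / kappa)) => B B0.
  pose Y := ub (16 * alpha * G / kappa).
  have Y0 : (0 < Y)%N := ub0 _.
  have hY : 16 * alpha * G <= kappa * Y%:R.
    by rewrite -ler_pdivrMl // mulrC; apply: ubP; rewrite divr_ge0 ?mulr_ge0 // ltW.
  exists (16 * alpha * Y.+1%:R / kappa + 1) => N Q S ar hL _ hk.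
  have L0 : 0 < wsum l Q predT.
    by apply: lt_le_trans hL; rewrite ltr_wpDl // divr_ge0 ?mulr_ge0 // ltW.
  have hk' : kappa * wsum l Q predT <= wsum l Q (fun p => (nres p S)%:R <= alpha).
    by apply: le_trans hk _; apply: (wsum_le (ar_ge0 ar)) => p _; rewrite expr0 mulr1.
  have h2 : 16 * alpha * Y.+1%:R <= kappa * wsum l Q predT.
    by rewrite -ler_pdivrMl // mulrC; lra.
  have := card_few_classes ar L0 al0 ka0 Y0 hY h2 hk'.
  exists S; split=> //.
    rewrite expn0 muln1 -(ler_nat R); apply: le_trans (ubP _ _).
      by rewrite ler_pdivlMr // mulrC.
    by rewrite divr_ge0 ?mulr_ge0 // ltW.
  move=> Z _; rewrite -setD_eq0 => /eqP ->.
  by rewrite cards0 mulr_ge0 // ltW.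
(* The proportion of atypical points, [10 * delta / kappa], is then below [eta / 4]. *)
pose delta := eta * kappa / 64.
have de0 : 0 < delta by rewrite divr_gt0 // mulr_gt0.
have [K3 [q1 [K30 hK3]]] := classes_spread l j0 k G1 de0.
pose K := 8 * G / (delta * kappa) + 2 * G / delta.
have K0 : 0 < K by rewrite addr_gt0 // divr_gt0 // mulr_gt0.
have dk0 : 0 < delta * kappa by rewrite mulr_gt0.
have hKa : 2 * G / K <= delta * kappa / 4.
  rewrite ler_pdivrMr //; have -> : delta * kappa / 4 * K = 2 * G + G * kappa / 2.
    by rewrite /K; field; rewrite !gt_eqF.
  by rewrite lerDl divr_ge0 // mulr_ge0 // ltW.
have hKb : 2 * G / K <= delta.
  rewrite ler_pdivrMr //; have -> : delta * K = 8 * G / kappa + 2 * G.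
    by rewrite /K; field; rewrite !gt_eqF.
  by rewrite lerDr divr_ge0 ?mulr_ge0 // ltW.
pose alpha' := 4 * d%:R * alpha * K / (delta * kappa).
have al'0 : 0 < alpha' by rewrite divr_gt0 // !mulr_gt0.
have hal : d%:R * alpha * K <= delta * kappa / 4 * alpha'.
  by rewrite le_eqVlt; apply/orP; left; apply/eqP; rewrite /alpha'; field; rewrite !gt_eqF.
pose c := delta / alpha.
have c0 : 0 < c by rewrite divr_gt0.
have hc : alpha * c <= delta by rewrite /c mulrC divfK // gt_eqF.
pose cr := c / (2 * d%:R * K).
have cr0 : 0 < cr by rewrite divr_gt0 // !mulr_gt0.
pose c2 := c / (2 * K3).
have c20 : 0 < c2 by rewrite divr_gt0 // mulr_gt0.
pose n0 := ub (32 * (2 + G) / (eta * c2 * kappa)).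
have n00 : 0 < n0%:R :> R by rewrite ltr0n.
have ecr0 : 0 < eta * c2 * kappa by apply: mulr_gt0 (mulr_gt0 eta0 c20) ka0.
have hn0 : 2 + G < eta / 4 * (c2 * kappa / 8) * n0%:R.
  have : 32 * (2 + G) < eta * c2 * kappa * n0%:R.
    rewrite -ltr_pdivrMl // mulrC; apply: ubPt.
    by apply: divr_ge0 (ltW ecr0); rewrite mulr_ge0 // addr_ge0 // ltW.
  lra.
pose D := d%:R * (K * K3) / cr.
have D0 : 0 < D by apply: divr_gt0 cr0; apply: mulr_gt0 dR (mulr_gt0 K0 K30).
(* The loss over [n0 * B] sections is compared with a multiple of [B]; the factors [B] cancel, so
   neither [eta'] nor the constant [C] of the induction depends on [B]. *)
pose eta' := eta / (4 * n0%:R * D).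
have eta'0 : 0 < eta' by apply: divr_gt0 eta0 (mulr_gt0 (mulr_gt0 _ n00) D0).
have ka20 : 0 < kappa / 2 by rewrite divr_gt0.
have [C hC] := IH alpha' (kappa / 2) eta' al'0 ka20 eta'0.
exists (n0 * C)%N => B B0; have [q2 hq2] := hC B B0.
pose Y := ub (16 * B%:R / kappa).
have Y0 : (0 < Y)%N := ub0 _.
have hY : 2 * B%:R <= kappa / 8 * Y%:R.
  have : 16 * B%:R <= kappa * Y%:R.
    by rewrite -ler_pdivrMl // mulrC; apply: ubP; rewrite divr_ge0 ?mulr_ge0 // ltW.
  lra.
(* Thresholds for the total weight, and through [ar_L_le] for [Q]. Dependence on [B] is allowed
   here, as [q0] comes after [B]. *)
pose t1 := 8 * Y.+1%:R / kappa; pose t2 := d%:R * G / (c2 * kappa / 8); pose t3 := 2 * d%:R / delta.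
have t10 : 0 <= t1 by apply: divr_ge0 (mulr_ge0 _ _) (ltW ka0).
have ck0 : 0 < c2 * kappa / 8 by apply: divr_gt0 (mulr_gt0 c20 ka0) _.
have t20 : 0 <= t2 by apply: divr_ge0 (mulr_ge0 (ltW dR) (ltW G0)) (ltW ck0).
have t30 : 0 <= t3 by apply: divr_ge0 (mulr_ge0 _ _) (ltW de0).
exists (Num.max q1 (Num.max q2 (t1 + t2 + t3 + 1))) => N Q S ar.
rewrite !ge_max => /and3P[q1L q2L tL] hS hfew.
have hLQ := ar_L_le ar; rewrite -natr1 in hLQ.
have L0 : 0 < wsum l Q predT by lra.
have [iota fib small] := slicing_exists ar j0 hS.
have hY2 : Y.+1%:R <= kappa / 8 * wsum l Q predT.
  have : t1 <= wsum l Q predT by lra.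
  rewrite ler_pdivrMr //; lra.
have hQ2 : d%:R * G <= c2 * kappa / 8 * Q%:R.
  by rewrite -ler_pdivrMl // mulrC -/t2; lra.
have hQ3 : 2 * d%:R <= delta * Q%:R.
  by rewrite -ler_pdivrMl // mulrC -/t3; lra.
have hn : 2 * B%:R + G < eta / 4 * (c2 * kappa / 8) * (n0 * B)%:R.
  have B1 : 1 <= B%:R :> R by rewrite ler1n.
  have BR : 0 < B%:R :> R by rewrite ltr0n.
  rewrite natrM mulrA; have := hn0; rewrite -(ltr_pM2r BR).
  have := ler_wpM2l (ltW G0) B1; lra.
have [s [ss sS hU]] := meets_covering k alpha alpha' ar L0 d0 c0 K0 K30 fib (erefl cr)
  B0 (divr_gt0 eta0 (ltr0Sn R 3)) ka0 Y0 hY hY2 hQ2 hn.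
have hsec x : x \in S -> large Q k iota S x ->
     \sum_(z in sec iota S x) wsum l Q (fun p => K3 * #|sec iota S x|%:R
           < #|cls p (sec iota S x) z|%:R * p%:R ^+ k) <= delta * wsum l Q predT * #|sec iota S x|%:R.
  by move=> xS lx; apply: hK3.
have hT := @card_atypical R l G N Q d k iota S alpha alpha' kappa K K3 c delta ar L0 de0 ka0 K0
  al'0 (ltW c0) fib small hQ3 hKa hKb hal hc hsec hfew.
have hT' : #|S :\: typical l Q k iota S alpha alpha' kappa K K3 c|%:R <= eta / 4 * #|S|%:R.
  rewrite -(ler_pM2l ka0); apply: le_trans hT _; rewrite /delta.
  have := mulr_ge0 (ltW (mulr_gt0 eta0 ka0)) (ler0n R #|S|); lra.
have exA y : exists A : {set gridpt d N}, y \in S -> large Q k iota S y ->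
    rich l Q k iota S alpha' kappa y ->
    [/\ A \subset sec iota S y, (#|A| <= C * B ^ k)%N &
      characteristic l Q B%:R eta' (sec iota S y) A].
  have [/and3P[yS ly ry]|] :=
    boolP [&& y \in S, large Q k iota S y & rich l Q k iota S alpha' kappa y].
    by have [A hA] := hq2 N Q _ ar q2L ly ry; exists A.
  by move=> h; exists set0 => yS ly ry; move: h; rewrite yS ly ry.
have [A hA] := fin_all_exists exA.
exists (\bigcup_(y <- s | large Q k iota S y && rich l Q k iota S alpha' kappa y) A y).
split.
- rewrite big_seq_cond; elim/big_ind: _ => [|X1 X2 h1 h2|y /andP[ys /andP[ly ry]]].
  + exact: sub0set.
  + by rewrite subUset h1.
  + have [sA _ _] := hA y (sS y ys) ly ry.
    exact: subset_trans sA (sec_sub _ _ _).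
- apply: (@leq_trans (\sum_(y <- s) C * B ^ k)); last first.
    rewrite big_const_seq count_predT iter_addn_0 mulnC expnS.
    rewrite (_ : n0 * C * (B * B ^ k) = n0 * B * (C * B ^ k))%N; last by ring.
    by rewrite leq_mul2r ss orbT.
  rewrite big_seq_cond [leqRHS]big_seq.
  apply: (@leq_trans (\sum_(y <- s | (y \in s) &&
      (large Q k iota S y && rich l Q k iota S alpha' kappa y)) C * B ^ k)).
    elim/big_ind2: _ => [|X1 m1 X2 m2 h1 h2|y /andP[ys /andP[ly ry]]].
    + by rewrite cards0.
    + by apply: leq_trans (leq_card_setU _ _) _; apply: leq_add.
    + by have [_ cA _] := hA y (sS y ys) ly ry.
  rewrite big_mkcondr /=; apply: leq_sum => y _; by case: ifP.
- apply: (characteristic_union (cr := cr) ar L0 d0 c0 K0 K30 (erefl cr) B0 (ltW eta'0) ss sS _ hU hT').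
    by move=> y yS ly ry; have [] := hA y yS ly ry.
  rewrite (_ : eta' * (d%:R * (K * K3)) / cr = eta' * D); last by rewrite /D !mulrA.
  rewrite natrM /eta' le_eqVlt; apply/orP; left; apply/eqP; field.
  by rewrite !gt_eqF.
Qed.

(** * Lower bound for the sum of [ln p / p] *)

Local Notation RR := Rdefinitions.R.

Definition lnn (n : nat) : RR := Rpower.ln (Raxioms.INR n).

Lemma INR_gt0 n : (0 < n)%N -> Rdefinitions.Rlt Rdefinitions.R0 (Raxioms.INR n).
Proof. by move=> n0; apply/RltP; rewrite INRE ltr0n. Qed.

Lemma lnnM m n : (0 < m)%N -> (0 < n)%N -> lnn (m * n) = lnn m + lnn n.
Proof. by move=> m0 n0; rewrite /lnn RIneq.mult_INR Rpower.ln_mult //; apply: INR_gt0. Qed.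

Lemma lnn1 : lnn 1 = 0.
Proof. exact: Rpower.ln_1. Qed.

Lemma ler_lnn m n : (0 < m)%N -> (m <= n)%N -> lnn m <= lnn n.
Proof.
move=> m0; rewrite leq_eqVlt => /orP[/eqP ->//|mn].
apply/RleP/RIneq.Rlt_le/Rpower.ln_increasing; first exact: INR_gt0.
by apply/RltP; rewrite !INRE ltr_nat.
Qed.

Lemma lnn_ge0 n : (0 < n)%N -> 0 <= lnn n.
Proof. by move=> n0; rewrite -lnn1; apply: ler_lnn. Qed.

Lemma lnn_le n : (0 < n)%N -> lnn n <= n%:R.
Proof.
move=> n0; rewrite -INRE.
have /RleP := Rpower.exp_ineq1_le (lnn n).
rewrite /lnn Rpower.exp_ln; last exact: INR_gt0.
by apply: le_trans; rewrite RplusE lerDr ler01.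
Qed.

Lemma lnnX m n : (0 < m)%N -> lnn (m ^ n)%N = n%:R * lnn m.
Proof.
move=> m0; elim: n => [|n IH]; first by rewrite mul0r lnn1.
by rewrite expnS lnnM ?expn_gt0 ?m0 // IH -natr1; ring.
Qed.

Lemma lnn_prod m (P : pred nat) (F : nat -> nat) : (forall p, P p -> 0 < F p)%N ->
  lnn (\prod_(p < m | P p) F p)%N = \sum_(p < m | P p) lnn (F p).
Proof.
move=> F0; suff [] : (0 < \prod_(p < m | P p) F p)%N /\
    lnn (\prod_(p < m | P p) F p)%N = \sum_(p < m | P p) lnn (F p) by [].
elim/big_rec2: _ => [|p y1 y2 Pp [y0 IH]]; first by rewrite lnn1.
by rewrite muln_gt0 y0 F0 // lnnM ?F0 // IH.
Qed.

Lemma lnn_primes n m : (0 < n)%N -> (forall p, prime p -> (p %| n)%N -> (p <= m)%N) ->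
  lnn n = \sum_(p < m.+1 | prime p) (logn p n)%:R * lnn p.
Proof.
move=> n0 hm.
have hn : n = (\prod_(p < m.+1 | prime p) p ^ logn p n)%N.
  have lognp p : ~~ prime p || (m < p)%N -> (p ^ logn p n = 1)%N.
    case/orP => [np|mp]; first by rewrite lognE (negbTE np).
    rewrite lognE; case: ifP => // /and3P[pp _ /(hm p pp)].
    by rewrite leqNgt mp.
  rewrite -{1}(partnT n0) (widen_partn _ (leq_maxl n m)) big_mkcond /= big_mkord.
  rewrite [RHS](big_ord_widen_cond (maxn n m).+1 (fun p => prime p) (fun p => p ^ logn p n)%N);
    last by rewrite ltnS leq_maxr.
  rewrite [RHS]big_mkcond; apply: eq_bigr => p _ /=.
  by case: ifPn => //; rewrite negb_and -leqNgt => /lognp.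
rewrite {1}hn (@lnn_prod m.+1 prime (fun p => p ^ logn p n)%N); last first.
  by move=> p pp; rewrite expn_gt0 prime_gt0.
by apply: eq_bigr => p pp; rewrite lnnX // prime_gt0.
Qed.

Lemma lsum_lnn_dvd Q (P : pred nat) n : (0 < n)%N ->
  (forall p, prime p -> P p -> (p %| n)%N) -> lsum lnn Q P <= lnn n.
Proof.
move=> n0 hP; rewrite (@lnn_primes n (maxn n Q)) //; last first.
  by move=> p _ /dvdn_leq h; apply: leq_trans (h n0) (leq_maxl _ _).
rewrite /lsum (big_ord_widen_cond (maxn n Q).+1 (fun p => prime p && P p) lnn);
  last by rewrite ltnS leq_maxr.
rewrite [leLHS]big_mkcond [leRHS]big_mkcond /=; apply: ler_sum => p _.
have [pp|] := boolP (prime p); rewrite //=.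
have l0 := lnn_ge0 (prime_gt0 pp).
case: ifP => [/andP[/(hP p pp) pn _]|_]; last by rewrite mulr_ge0.
by rewrite -[leLHS]mul1r ler_wpM2r // ler1n logn_gt0 mem_primes pp n0.
Qed.

(** Legendre's formula: [h] telescopes to bound [p.-1] times the exponent by [n], and
    [p <= 2 * p.-1]. *)
Lemma logn_fact_le p n : prime p -> (p * logn p n`! <= 2 * n)%N.
Proof.
move=> pp; have p1 := prime_gt1 pp.
have h m : (p.-1 * (\sum_(1 <= k < m.+1) n %/ p ^ k) + n %/ p ^ m <= n)%N.
  elim: m => [|m IH]; first by rewrite big_geq // muln0 expn0 divn1.
  rewrite big_nat_recr //= mulnDr; apply: leq_trans IH.
  rewrite -addnA leq_add2l -{2}[(n %/ p ^ m.+1)%N]mul1n -mulnDl addn1 prednK ?prime_gt0 //.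
  by rewrite expnSr divnMA mulnC leq_trunc_div.
have := h n; rewrite -logn_fact // => h1.
have : (p <= 2 * p.-1)%N by case: p p1 {pp h h1} => // p; lia.
move=> h2; apply: leq_trans (leq_mul h2 (leqnn _)) _.
by rewrite -mulnA leq_mul2l /=; apply: leq_trans h1; apply: leq_addr.
Qed.

(** Pair the factors [i + 1] and [n - i] of two copies of the factorial: their product is at least
    [n]. *)
Lemma expn_le_fact2 n : (n ^ n <= n`! ^ 2)%N.
Proof.
have h : n`! = (\prod_(i < n) i.+1)%N by rewrite fact_prod big_add1 big_mkord.
have h' : n`! = (\prod_(i < n) (n - i))%N.
  rewrite h (reindex_inj rev_ord_inj) /=; apply: eq_bigr => i _; have := ltn_ord i; lia.
rewrite expnS expn1 {2}h' h -big_split /= -{2}(card_ord n) -prod_nat_const.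
apply: leq_prod => i _; move: (nat_of_ord i) (ltn_ord i) => j jn.
by rewrite -{1}(subnK (ltnW jn)) mulSn leq_add2l leq_pmulr // subn_gt0.
Qed.

(** A lower bound of Mertens type: [Q log Q] is at most twice the logarithm of the factorial of [Q],
    whose prime factorisation gives at most [2 * Q] times the sum of [log p / p]. *)
Lemma lnn_le_wsum Q : lnn Q <= 4 * wsum lnn Q predT.
Proof.
case: (posnP Q) => [->|Q0].
  have -> : lnn 0 = 0.
    rewrite /lnn /Rpower.ln; case: RIneq.Rlt_dec => //= h.
    by have /RltP := h; rewrite ltxx.
  by rewrite mulr_ge0 // wsum_ge0 // => p /prime_gt0; apply: lnn_ge0.
have QR : 0 < Q%:R :> RR by rewrite ltr0n.
have h1 : Q%:R * lnn Q <= 2 * lnn Q`!.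
  rewrite -lnnX // -lnnX ?fact_gt0 //; apply: ler_lnn (expn_le_fact2 Q).
  by rewrite expn_gt0 Q0.
have h2 : lnn Q`! <= 2 * Q%:R * wsum lnn Q predT.
  rewrite (@lnn_primes _ Q) ?fact_gt0 //; last first.
    move=> p pp; elim: (Q) => [|n IH]; first by rewrite fact0 Euclid_dvd1.
    by rewrite factS Euclid_dvdM // => /orP[/dvdn_leq ->|/IH/leqW].
  rewrite /wsum mulr_sumr big_mkcond [leRHS]big_mkcond /=; apply: ler_sum => p _.
  rewrite andbT; case: ifP => // pp.
  have l0 := lnn_ge0 (prime_gt0 pp); have p0 := prime_natr_gt0 RR pp.
  have := logn_fact_le Q pp; rewrite -(ler_nat RR) !natrM => h.
  rewrite mulrCA mulrC; apply: ler_wpM2l => //.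
  by rewrite ler_pdivlMr // mulrC.
rewrite -(ler_pM2l QR); lra.
Qed.

(** With [L] the total weight, the factor 8 covers both [log |a - b| <= g log Q <= 4 g L] and
    [(Q + 1) log Q <= 8 Q L]. *)
Lemma arith_lnn (g N Q : nat) : (0 < g)%N -> (0 < N)%N -> (1 < Q)%N -> (N <= Q ^ g)%N ->
  arith lnn (8 * g)%:R N Q.
Proof.
move=> g0 N0 Q1 NQ; have Q0 : (0 < Q)%N by apply: ltnW.
have l0 p : prime p -> 0 <= lnn p by move=> /prime_gt0; apply: lnn_ge0.
have L0 : 0 <= wsum lnn Q predT by apply: wsum_ge0.
have gR : 1 <= g%:R :> RR by rewrite ler1n.
have hL := lnn_le_wsum Q.
split=> //.
- by move=> p /prime_gt0; apply: lnn_le.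
- by rewrite ler1n muln_gt0.
- move=> a b aN bN ab.
  wlog lt_ab : a b aN bN ab / (a < b)%N.
    move=> wl; move: ab; rewrite neq_ltn => /orP[h|h]; first by apply: wl => //; rewrite neq_ltn h.
    apply: le_trans (wl b a bN aN _ h); last by rewrite neq_ltn h.
    by apply: (lsum_le l0) => p _; rewrite eq_sym.
  apply: (@le_trans _ _ (lnn (b - a))).
    apply: lsum_lnn_dvd; first by rewrite subn_gt0.
    by move=> p _ /eqP h; rewrite -eqn_mod_dvd ?(ltnW lt_ab) // h.
  apply: (@le_trans _ _ (lnn (Q ^ g))).
    by apply: ler_lnn; [rewrite subn_gt0 | apply: leq_trans (leq_subr _ _) (leq_trans bN NQ)].
  rewrite lnnX // natrM; have := ler_wpM2l (ler0n RR g) hL.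
  have := mulr_ge0 (ler0n RR g) L0; lra.
- apply: (@le_trans _ _ (\sum_(p < Q.+1) lnn Q)).
    rewrite /lsum big_mkcond; apply: ler_sum => p _; rewrite andbT; case: ifP => [pp|_].
      by apply: ler_lnn; rewrite ?prime_gt0 // -ltnS.
    exact: lnn_ge0.
  rewrite sumr_const card_ord -[leLHS]mulr_natl natrM.
  have QR : 1 <= Q%:R :> RR by rewrite ler1n.
  have h1 : Q.+1%:R <= 2 * Q%:R :> RR by rewrite -natr1; lra.
  apply: le_trans (ler_wpM2r (lnn_ge0 Q0) h1) _.
  have Q2 : 0 <= 2 * Q%:R :> RR by lra.
  apply: le_trans (ler_wpM2l Q2 hL) _.
  have h2 := ler_wpM2r (mulr_ge0 (ler0n RR Q) L0) gR; lra.
Qed.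

(** * Interpolation *)

Section Interpolation.
Variables (d r H : nat).
Implicit Types (c : {ffun {ffun 'I_d -> 'I_r} -> 'I_H.+1}) (e : {ffun 'I_d -> 'I_r}).

Definition evaln N c (x : gridpt d N) : nat := (\sum_e c e * \prod_i x i ^ e i)%N.

Definition mnm e : 'X_{1..d} := [multinom (e i : nat) | i < d].

(* Interpolating polynomials are differences of two polynomials with natural coefficients,
   so that congruences and sizes of their values are those of natural numbers. *)
Definition diff_poly (c1 c2 : {ffun {ffun 'I_d -> 'I_r} -> 'I_H.+1}) : {mpoly int[d]} :=
  \sum_e ((c1 e : nat)%:Z - (c2 e : nat)%:Z) *: 'X_[mnm e].

Lemma mnm_inj : injective mnm.
Proof.
move=> e e' /mnmP h; apply/ffunP => i; apply: val_inj => /=.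
by have := h i; rewrite !mnmE.
Qed.

Lemma evaln_le N c (x : gridpt d N) : (0 < N)%N -> (evaln c x <= r ^ d * (H * N ^ (d * r)))%N.
Proof.
move=> N0; rewrite /evaln; have -> : (r ^ d = #|{ffun 'I_d -> 'I_r}|)%N.
  by rewrite card_ffun !card_ord.
rewrite -sum_nat_const; apply: leq_sum => e _; apply: leq_mul; first exact: leq_ord.
have -> : (N ^ (d * r) = \prod_(i < d) N ^ r)%N by rewrite prod_nat_const card_ord -expnM mulnC.
apply: leq_prod => i _; apply: (@leq_trans (N ^ e i)); last by rewrite leq_pexp2l // ltnW.
by case: (val (e i)) => [|n]; rewrite ?expn0 // leq_exp2r // leq_ord.
Qed.

Lemma evaln_red N p c (x y : gridpt d N) : red p x = red p y -> evaln c x = evaln c y %[mod p].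
Proof.
move=> /eqP/red_eqP h; rewrite /evaln.
elim/big_ind2: _ => // [x1 x2 y1 y2 h1 h2|e _]; first by rewrite -modnDm h1 h2 modnDm.
rewrite -modnMmr -[RHS]modnMmr; congr (_ * _ %% _)%N.
elim/big_ind2: _ => // [x1 x2 y1 y2 h1 h2|i _]; first by rewrite -modnMm h1 h2 modnMm.
by rewrite -modnXm h modnXm.
Qed.

Lemma diff_poly_eval N c1 c2 (x : gridpt d N) :
  (diff_poly c1 c2).@[ptZ x] = (evaln c1 x : int) - (evaln c2 x : int).
Proof.
have evalZ c : (evaln c x : int) = \sum_e (c e : nat)%:Z * \prod_i ptZ x i ^+ e i.
  rewrite /evaln -natz natr_sum; apply: eq_bigr => e _; rewrite natrM natr_prod; congr (_ * _).
    by rewrite natz.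
  by apply: eq_bigr => i _; rewrite natrX /ptZ natz.
rewrite !evalZ -sumrB /diff_poly raddf_sum /=; apply: eq_bigr => e _.
rewrite mevalZ mevalX mulrBl; congr (_ * _ - _ * _); apply: eq_bigr => i _; by rewrite mnmE.
Qed.

Lemma diff_poly_coeff c1 c2 e : (diff_poly c1 c2)@_(mnm e) = (c1 e : nat)%:Z - (c2 e : nat)%:Z.
Proof.
rewrite /diff_poly raddf_sum /= (bigD1 e) //= mcoeffZ mcoeffX eqxx mulr1 big1 ?addr0 // => e' ne.
by rewrite mcoeffZ mcoeffX (inj_eq mnm_inj) (negbTE ne) mulr0.
Qed.

Lemma diff_poly_supp c1 c2 m : (diff_poly c1 c2)@_m != 0 -> exists e, m = mnm e.
Proof.
move=> h; have [/existsP[e /eqP ->]|/existsPn n] := boolP [exists e, m == mnm e]; first by exists e.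
move: h; rewrite /diff_poly raddf_sum /= big1 ?eqxx // => e _.
by rewrite mcoeffZ mcoeffX eq_sym (negbTE (n e)) mulr0.
Qed.

Lemma abscoef_diff_poly c1 c2 m : (abscoef (diff_poly c1 c2) m <= H)%N.
Proof.
rewrite /abscoef; have [-> //|/diff_poly_supp[e ->]] := eqVneq ((diff_poly c1 c2)@_m) 0.
rewrite diff_poly_coeff; have := leq_ord (c1 e); have := leq_ord (c2 e); lia.
Qed.

Lemma tdeg_diff_poly c1 c2 : (tdeg (diff_poly c1 c2) <= d * r)%N.
Proof.
rewrite /tdeg; suff: (msize (diff_poly c1 c2) <= (d * r).+1)%N by case: (msize _).
rewrite msizeE.
apply/bigmax_leqP_seq => m; rewrite mcoeff_msupp => /diff_poly_supp[e ->] _.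
rewrite ltnS mdegE -[X in (_ <= X * _)%N](card_ord d) -sum_nat_const; apply: leq_sum => i _.
by rewrite mnmE ltnW.
Qed.

Lemma diff_poly_neq0 c1 c2 : c1 != c2 -> diff_poly c1 c2 != 0.
Proof.
apply: contraNneq => f0; apply/eqP/ffunP => e; apply: val_inj; apply/eqP => /=.
have := diff_poly_coeff c1 c2 e; rewrite f0 mcoeff0 => /esym/eqP.
by rewrite subr_eq0.
Qed.

End Interpolation.

(* Siegel's lemma, by the pigeonhole principle. *)
Lemma siegel d r N (A : {set gridpt d N}) : (0 < N)%N -> (0 < r)%N -> (2 * #|A| <= r ^ d)%N ->
  exists c1 c2 : {ffun {ffun 'I_d -> 'I_r} -> 'I_(r ^ d * N ^ (d * r)).+1},
    c1 != c2 /\ forall x, x \in A -> evaln c1 x = evaln c2 x.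
Proof.
(* This height turns the bound of [evaln_le] into [H * H]. *)
move=> N0 r0 hA; set H := (r ^ d * N ^ (d * r))%N.
have H0 : (0 < H)%N by rewrite muln_gt0 !expn_gt0 r0 N0.
pose coefs := {ffun {ffun 'I_d -> 'I_r} -> 'I_H.+1}.
have ev_le (c : coefs) (x : gridpt d N) : (evaln c x <= H * H)%N.
  by apply: leq_trans (evaln_le c x N0) _; rewrite mulnCA.
pose g (c : coefs) : {ffun 'I_#|A| -> 'I_(H * H).+1} := [ffun i => inord (evaln c (enum_val i))].
have [gI|] := boolP (injectiveb g); last first.
  move=> /injectivePn[c1 [c2 ne eg]]; exists c1, c2; split=> // x xA.
  move/ffunP/(_ (enum_rank_in xA x)): eg; rewrite !ffunE enum_rankK_in // => /(congr1 val).
  by rewrite /= !inordK // ltnS.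
exfalso; have := leq_card g (injectiveP _ gI); rewrite !card_ffun !card_ord => h.
(* Injectivity would contradict [(H + 1)^2 > H^2 + 1]: there are at least two coefficients for each
   point of [A]. *)
have h2 : (H.+1 ^ (2 * #|A|) <= (H * H).+1 ^ #|A|)%N.
  by apply: leq_trans h; rewrite leq_pexp2l.
case: (posnP #|A|) => [A0|A0].
  move: h; rewrite A0 expn0 leqNgt => /negP; apply.
  by rewrite -[X in (X < _)%N](expn0 H.+1) ltn_exp2l // expn_gt0 r0.
move: h2; rewrite expnM leq_exp2r // leqNgt => /negP; apply.
by rewrite expnS expn1; nia.
Qed.

Definition interpolates (d N C : nat) (A : {set gridpt d N}) (f : {mpoly int[d]}) :=
  [/\ mpoly_nonzero f, (tdeg f <= C)%N, forall m, (abscoef f m <= N ^ C)%N &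
      forall x, x \in A -> vanishes_at f x].

Lemma diff_poly_interpolates d r H N C (A : {set gridpt d N})
    (c1 c2 : {ffun {ffun 'I_d -> 'I_r} -> 'I_H.+1}) :
  c1 != c2 -> (forall x, x \in A -> evaln c1 x = evaln c2 x) ->
  (H <= N ^ C)%N -> (d * r <= C)%N -> interpolates C A (diff_poly c1 c2).
Proof.
move=> c12 hA hH hr; split.
- exact: diff_poly_neq0.
- exact: leq_trans (tdeg_diff_poly _ _) hr.
- by move=> m; apply: leq_trans (abscoef_diff_poly _ _ _) hH.
- by move=> x xA; rewrite /vanishes_at diff_poly_eval hA // subrr.
Qed.

Lemma siegel_height d r N : (1 < N)%N -> (r ^ d * N ^ (d * r) <= N ^ (2 * (d * r)))%N.
Proof.
move=> N1; rewrite mul2n -addnn expnD leq_mul2r; apply/orP; right.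
rewrite mulnC expnM; case: d => [|d]; first by rewrite !expn0.
rewrite leq_exp2r //; apply: leq_trans (ltnW (ltn_expl r (ltnSn 1))) _.
by case: r => [|r]; rewrite ?expn0 // leq_exp2r.
Qed.

(** Disposes of bounded [N], for which the sieve does not apply: the whole grid then lies on one
    hypersurface of bounded degree. *)
Lemma interpolates_setT d N0 : (0 < d)%N -> exists C : nat, forall N, (0 < N)%N -> (N < N0)%N ->
  exists f, interpolates C [set: gridpt d N] f.
Proof.
move=> d0; pose C := (3 * d + 2 * (d * (2 * N0)))%N.
exists C => N N_gt0 NN0.
have [N1|N1] := ltnP 1 N.
  have hA : (2 * #|[set: gridpt d N]| <= (2 * N0) ^ d)%N.
    rewrite cardsT card_ffun !card_ord expnMn; apply: leq_mul.
      by rewrite -{1}(expn1 2) leq_pexp2l.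
    by rewrite leq_exp2r.
  have r0 : (0 < 2 * N0)%N by rewrite muln_gt0 (leq_ltn_trans _ NN0).
  have [c1 [c2 [c12 hc]]] := siegel N_gt0 r0 hA.
  exists (diff_poly c1 c2); apply: diff_poly_interpolates => //.
    by apply: leq_trans (siegel_height _ _ N1) _; rewrite leq_pexp2l // leq_addl.
  by rewrite /C; lia.
have {}N1 : N = 1%N by apply/eqP; rewrite eqn_leq N1.
subst N.
(* At [N = 1] the height bound [N ^ C] is 1 whatever [C], so Siegel's lemma gives way to the
   explicit [x - x^2] in the coordinate [j0], with [r = 3]. *)
pose j0 := Ordinal d0.
pose e (a : 'I_3) : {ffun 'I_d -> 'I_3} := [ffun i => if i == j0 then a else ord0].
pose c (a : 'I_3) : {ffun {ffun 'I_d -> 'I_3} -> 'I_2} :=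
  [ffun e' => if e' == e a then ord_max else ord0].
have ev a (x : gridpt d 1) : evaln (c a) x = (x j0 ^ a)%N.
  rewrite /evaln (bigD1 (e a)) //= [X in (_ + X)%N]big1 ?addn0; last first.
    by move=> e' ne; rewrite ffunE (negbTE ne).
  rewrite ffunE eqxx mul1n (bigD1 j0) //= ffunE eqxx [X in (_ * X)%N]big1 ?muln1 // => i ne.
  by rewrite ffunE (negbTE ne).
pose a1 : 'I_3 := Ordinal (isT : (1 < 3)%N); pose a2 : 'I_3 := Ordinal (isT : (2 < 3)%N).
exists (diff_poly (c a1) (c a2)); apply: diff_poly_interpolates => //.
- apply/negP => /eqP/ffunP/(_ (e a2)); rewrite !ffunE eqxx.
  case: eqP => // /ffunP/(_ j0); rewrite !ffunE eqxx => /(congr1 val) //.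
- by move=> x _; rewrite !ev /=; case: (x j0) => -[|[|]].
- by rewrite exp1n.
- by rewrite mulnC leq_addr.
Qed.

(** * From sieved sets to polynomials *)

Lemma lnn_ltW m n : (0 < n)%N -> lnn m < lnn n -> (m <= n)%N.
Proof. by move=> n0; apply: contraTT; rewrite -ltnNge -leNgt => /ltnW; apply: ler_lnn. Qed.

Lemma root_exists e N : (0 < e)%N -> (0 < N)%N ->
  exists Q, [/\ (0 < Q)%N, (Q ^ e <= N)%N & (N < Q.+1 ^ e)%N].
Proof.
move=> e0 N0.
have ex : exists n, (n ^ e <= N)%N by exists 0; rewrite exp0n.
have ub n : (n ^ e <= N)%N -> (n <= N)%N.
  by move=> h; apply: leq_trans h; rewrite -{1}(expn1 n); case: n => // n; rewrite leq_pexp2l.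
case: (ex_maxnP ex ub) => Q hQ Qmax; exists Q; split=> //.
  by apply: Qmax; rewrite exp1n.
by rewrite ltnNge; apply/negP => /Qmax; rewrite ltnn.
Qed.

(* The product of the primes [p] modulo which [x] agrees with a zero divides the difference of
   the two evaluations at [x]. *)
Lemma zeros_sieve_closed d r H N Q V (B : RR) (c1 c2 : {ffun {ffun 'I_d -> 'I_r} -> 'I_H.+1}) :
  (forall x : gridpt d N, evaln c1 x <= V)%N -> (forall x : gridpt d N, evaln c2 x <= V)%N ->
  lnn V <= B * wsum lnn Q predT ->
  sieve_closed lnn Q B [set x : gridpt d N | evaln c1 x == evaln c2 x].
Proof.
move=> h1 h2 hV x hx; rewrite inE; apply/negPn/negP => ne; move: hx.
rewrite ltNge => /negP; apply; apply: le_trans hV.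
pose n := (maxn (evaln c1 x) (evaln c2 x) - minn (evaln c1 x) (evaln c2 x))%N.
have n0 : (0 < n)%N by rewrite /n; lia.
have nV : (n <= V)%N by apply: leq_trans (leq_subr _ _) _; rewrite geq_max h1 h2.
apply: le_trans (ler_lnn n0 nV); apply: lsum_lnn_dvd => // p _ /existsP[z /andP[zZ /eqP zx]].
move: zZ; rewrite inE => /eqP ez.
have h : evaln c1 x = evaln c2 x %[mod p].
  by rewrite -(evaln_red c1 zx) -(evaln_red c2 zx) ez.
rewrite /n -eqn_mod_dvd; last by rewrite geq_min leq_maxl.
by rewrite /minn /maxn; case: ifP => _; rewrite h.
Qed.

Lemma sieved_set_algebraic (d k : nat) (eps alpha eta : RR) :
  (k < d)%N -> 0 < eps -> 0 < alpha -> 0 < eta ->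
  exists C : nat, forall N (S : {set gridpt d N}), (0 < N)%N -> S != set0 ->
    (forall p, prime p -> (nres p S)%:R <= alpha * p%:R ^+ k) ->
    (k%:R - 1 + eps) * lnn N < lnn #|S| ->
    exists f, [/\ mpoly_nonzero f, (tdeg f <= C)%N, forall m, (abscoef f m <= N ^ C)%N &
      #|S :\: [set x | vanishes_at f x]|%:R <= eta * #|S|%:R].
Proof.
move=> kd eps0 al0 eta0.
have d0 : (0 < d)%N by apply: leq_ltn_trans kd.
pose e := (2 * d + 2 + k)%N.
(* [Q] will be the integer part of [N ^ (1 / e')], so that [Q ^ e <= N ^ eps] as the size hypothesis
   of the sieve requires; conversely [N <= Q ^ (2 * e')] once [Q >= 2]. *)
pose e' := (Num.Def.archi_bound (e%:R / eps)).+1.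
have he' : e%:R <= eps * e'%:R.
  rewrite -ler_pdivrMl // mulrC; apply: le_trans (ltW (archi_boundP _)) _.
    by rewrite divr_ge0 // ltW.
  by rewrite ler_nat.
pose g := (2 * e')%N; pose G : RR := (8 * g)%:R.
have g0 : (0 < g)%N by [].
have G1 : 1 <= G by rewrite ler1n.
have [C hC] := @characteristic_set_exists _ lnn d (Ordinal d0) G k G1 alpha 1 eta al0 ltr01 eta0.
(* Values up to [N ^ (4 * (d * r))] have logarithm at most [16 * d * r * g * L], which dictates [B].
   As [C] does not depend on [B], this [r] ensures [2 * C * B ^ k <= r ^ k.+1 <= r ^ d], by
   [k < d]. *)
pose r := (2 * C * (32 * d * g) ^ k).+1.
pose B := (16 * d * r * g)%N.
have B0 : (0 < B)%N by rewrite !muln_gt0 d0.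
have [q0 hq0] := hC B B0.
(* From [N0] on, [Q >= 2] and, since [log N <= 4 * g * L], also [L >= q0]. *)
pose N0 := (maxn (2 ^ e') (Num.Def.archi_bound (Rtrigo_def.exp (g%:R * (4 * `|q0|))))).+1.
have [C0 hC0] := interpolates_setT N0 d0.
exists (maxn C0 (2 * (d * r))) => N S N_gt0 Sn0 hS hsize.
have [NN0|N0N] := ltnP N N0.
  have [f [f1 f2 f3 f4]] := hC0 N N_gt0 NN0; exists f; split=> //.
  - by apply: leq_trans f2 (leq_maxl _ _).
  - by move=> m; apply: leq_trans (f3 m) _; rewrite leq_pexp2l // leq_maxl.
  - rewrite (_ : _ :\: _ = set0) ?cards0 ?mulr_ge0 // ?ltW //.
    by apply/setP => x; rewrite !inE f4 ?inE.
have [Q [Q0 hQ1 hQ2]] := root_exists (ltn0Sn _ : (0 < e')%N) N_gt0.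
have Q1 : (1 < Q)%N.
  rewrite ltnNge; apply/negP => Q1; move: hQ2; rewrite ltnNge => /negP; apply.
  apply: (@leq_trans (2 ^ e')); first by rewrite leq_exp2r.
  by apply: leq_trans N0N; rewrite leqW // leq_maxl.
have NQ : (N <= Q ^ g)%N.
  apply: leq_trans (ltnW hQ2) _; rewrite /g expnM leq_exp2r //.
  by rewrite expnS expn1; apply: leq_trans (_ : 2 * Q <= _)%N; [lia | rewrite leq_mul2r Q1 orbT].
have ar := arith_lnn g0 N_gt0 Q1 NQ; rewrite -/G in ar.
set L := wsum lnn Q predT.
have hL : lnn Q <= 4 * L := lnn_le_wsum Q.
have lnNQ : lnn N <= g%:R * lnn Q.
  by rewrite -lnnX //; apply: ler_lnn.
have N1 : (1 < N)%N.
  apply: leq_trans N0N; rewrite ltnS; apply: leq_trans (leq_maxl _ _).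
  by rewrite expn_gt0.
have q0L : q0 <= L.
  have gR : 0 < g%:R :> RR by rewrite ltr0n.
  have h : g%:R * (4 * `|q0|) <= lnn N.
    rewrite -[leLHS]Rpower.ln_exp; set E := Rtrigo_def.exp _.
    have E0 := Exp_prop.exp_pos (g%:R * (4 * `|q0|)); rewrite -/E in E0.
    apply/RleP/RIneq.Rlt_le/Rpower.ln_increasing => //; apply/RltP; rewrite INRE.
    apply: lt_le_trans (archi_boundP _) _; first exact/RleP/RIneq.Rlt_le.
    by rewrite ler_nat; apply: leq_trans N0N; rewrite leqW // leq_maxr.
  have := le_trans h lnNQ; rewrite ler_pM2l // => h2.
  have := ler_norm q0; lra.
have S0 : (0 < #|S|)%N by rewrite card_gt0.
have size : (N ^ k * Q ^ (2 * d + 2 + k) <= #|S| * N)%N.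
  apply: lnn_ltW; first by rewrite muln_gt0 S0.
  rewrite !lnnM ?expn_gt0 ?N_gt0 ?Q0 // !lnnX // -/e.
  have h1 : e'%:R * lnn Q <= lnn N.
    by rewrite -lnnX //; apply: ler_lnn; rewrite ?expn_gt0 ?Q0.
  have h2 := ler_wpM2r (lnn_ge0 Q0) he'; have h3 := ler_wpM2l (ltW eps0) h1.
  lra.
have hfew : 1 * L <= wsum lnn Q (fun p => (nres p S)%:R <= alpha * p%:R ^+ k).
  by rewrite mul1r; apply: (wsum_le (ar_ge0 ar)) => p pp _; apply: hS.
have [A [AS cA charA]] := hq0 N Q S ar q0L size hfew.
have hA : (2 * #|A| <= r ^ d)%N.
  apply: (@leq_trans (2 * (C * B ^ k))); first by rewrite leq_mul2l cA.
  have hB : (B ^ k <= (32 * d * g) ^ k * r ^ k)%N.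
    rewrite -expnMn; case: (k) => // k'; rewrite leq_exp2r //.
    rewrite (_ : 32 * d * g * r = 2 * B)%N ?leq_pmull //.
    by rewrite /B; ring.
  apply: (@leq_trans (r * r ^ k)); last by rewrite -expnS leq_pexp2l.
  apply: (@leq_trans (2 * (C * ((32 * d * g) ^ k * r ^ k)))).
    by rewrite !leq_mul2l hB !orbT.
  by rewrite mulnA mulnA leq_mul2r; apply/orP; right; apply: leqW.
have r0 : (0 < r)%N by [].
have [c1 [c2 [c12 hc]]] := siegel N_gt0 r0 hA.
set H := (r ^ d * N ^ (d * r))%N in c1 c2 c12 hc.
have hH : (H <= N ^ (2 * (d * r)))%N := siegel_height d r N1.
have hr : (d * r <= 2 * (d * r))%N by rewrite leq_pmull.
have [f1 f2 f3 f4] := diff_poly_interpolates c12 hc hH hr.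
exists (diff_poly c1 c2); split=> //.
- by apply: leq_trans f2 (leq_maxr _ _).
- by move=> m; apply: leq_trans (f3 m) _; rewrite leq_pexp2l // leq_maxr.
have zeros : [set x | vanishes_at (diff_poly c1 c2) x] = [set x : gridpt d N | evaln c1 x == evaln c2 x].
  by apply/setP => x; rewrite !inE /vanishes_at diff_poly_eval subr_eq0.
have ev_le (c : {ffun {ffun 'I_d -> 'I_r} -> 'I_H.+1}) (x : gridpt d N) :
    (evaln c x <= N ^ (4 * (d * r)))%N.
  apply: leq_trans (evaln_le c x N_gt0) _.
  rewrite mulnCA -/H (_ : 4 * (d * r) = 2 * (d * r) + 2 * (d * r))%N; last by ring.
  by rewrite expnD leq_mul.
rewrite zeros; apply: charA; last by apply/subsetP => x xA; rewrite inE hc.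
apply: (zeros_sieve_closed (ev_le c1) (ev_le c2)).
rewrite lnnX //.
apply: (@le_trans _ _ ((4 * (d * r))%:R * (g%:R * (4 * L)))).
  rewrite ler_wpM2l //; apply: le_trans lnNQ _; by rewrite ler_wpM2l.
have -> : B%:R = 16 * d%:R * r%:R * g%:R :> RR by rewrite /B 3!natrM.
have -> : (4 * (d * r))%:R = 4 * (d%:R * r%:R) :> RR by rewrite 2!natrM.
have assoc (a b u v : RR) : 4 * (a * b) * (u * (4 * v)) = 16 * a * b * u * v by ring.
by rewrite assoc.
Qed.

Lemma sieved_set_dichotomy (d k : nat) (eps alpha eta : RR) :
  (k < d)%N -> 0 < eps -> 0 < alpha -> 0 < eta ->
  exists C : nat, forall N (S : {set gridpt d N}), (0 < N)%N ->
    (forall p, prime p -> (nres p S)%:R <= alpha * p%:R ^+ k) ->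
    #|S|%:R <= Rpower.Rpower (Raxioms.INR N) (k%:R - 1 + eps) \/
    exists f, [/\ mpoly_nonzero f, (tdeg f <= C)%N, forall m, (abscoef f m <= N ^ C)%N &
      (1 - eta) * #|S|%:R < #|[set x in S | vanishes_at f x]|%:R].
Proof.
(* Halving [eta] gives the strict inequality, as [S] is nonempty in the second case. *)
move=> kd eps0 al0 eta0; have eta20 : 0 < eta / 2 by rewrite divr_gt0.
have [C hC] := sieved_set_algebraic kd eps0 al0 eta20.
exists C => N S N0 hS; have [h|h] := leP (#|S|%:R) (Rpower.Rpower (Raxioms.INR N) (k%:R - 1 + eps)).
  by left.
right; have pow0 : 0 < Rpower.Rpower (Raxioms.INR N) (k%:R - 1 + eps).
  exact/RltP/Exp_prop.exp_pos.
have S0 : S != set0.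
  by apply/eqP => e; move: (lt_trans pow0 h); rewrite e cards0 ltxx.
have size : (k%:R - 1 + eps) * lnn N < lnn #|S|.
  apply/RltP; rewrite -[X in Rdefinitions.Rlt X _]Rpower.ln_exp.
  by apply: Rpower.ln_increasing; [exact/RltP | apply/RltP; rewrite INRE].
have [f [f0 fdeg fcoef fS]] := hC N S N0 S0 hS size; exists f; split=> //.
have cardS : #|S|%:R = #|[set x in S | vanishes_at f x]|%:R +
    #|S :\: [set x | vanishes_at f x]|%:R :> RR.
  rewrite -natrD -(cardsID [set x | vanishes_at f x] S); congr (_ + _)%:R.
  by apply: eq_card => x; rewrite !inE.
have Spos : 0 < #|S|%:R :> RR by rewrite ltr0n card_gt0.
have etaS := mulr_gt0 eta0 Spos; lra.
Qed.

From Stdlib Require Import Reals.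
Open Scope R_scope.

Theorem theorem1p1 :
  forall (d k : nat) (eps alpha : R),
    (k < d)%nat -> 0 < eps -> 0 < alpha ->
    exists C' : R, forall eta : R, 0 < eta ->
    exists C : R,
      forall (N : nat) (S : {set gridpt d N}),
        (0 < N)%nat ->
        (forall p : nat, prime p -> INR (nres p S) < alpha * Rpow_def.pow (INR p) k) ->
        INR #|S| <= C' * Rpower (INR N) (INR k - 1 + eps) \/
        (exists f : {mpoly int[d]},
            mpoly_nonzero f /\
            INR (tdeg f) <= C /\
            (forall m : 'X_{1..d}, INR (abscoef f m) <= Rpower (INR N) C) /\
            INR #|[set x in S | vanishes_at f x]| > (1 - eta) * INR #|S|).
Proof.
(* [C'] can be 1: the losses are powers of [Q] absorbed by [N ^ eps], and for small [N] a nonempty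
   [S] always satisfies the second alternative. *)
move=> d k eps alpha kd /RltP eps0 /RltP al0; exists 1 => eta /RltP eta0.
have [C hC] := sieved_set_dichotomy kd eps0 al0 eta0; exists (INR C) => N S N0 hS.
have [p pp||[f [f0 fdeg fcoef fS]]] := hC N S N0.
- by have /RltP := hS p pp; rewrite RmultE RpowE !INRE => /ltW.
- by rewrite Rmult_1_l => /RleP h; left; rewrite !INRE in h *.
right; exists f; split=> //; split; first by apply/RleP; rewrite !INRE ler_nat.
split=> [m|]; last by apply/RltP; rewrite !INRE.
rewrite Rpower_pow; last exact: INR_gt0.
by apply/RleP; rewrite RpowE !INRE -natrX ler_nat.
Qed.
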